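(* Let $X=(X_1,X_2)^\top\sim\mathcal N_2(\boldsymbol\mu,\boldsymbol\Sigma)$ be a bivariate normal random vector with mean $\boldsymbol\mu=(\mu_1,\mu_2)^\top\in\mathbb R^2$ and covariance matrix $\boldsymbol\Sigma$ having diagonal elements $\sigma_1^2,\sigma_2^2$ and off-diagonal element $\rho\sigma_1\sigma_2$, where $\sigma_1,\sigma_2>0$ and $|\rho|<1$. With the constants and functions defined in the context, $R=\sqrt{X_1^2+X_2^2}$ has cumulative distribution function $$F_R(u;\boldsymbol\mu,\boldsymbol\Sigma)=\frac{\alpha}{2\beta}\sum_{j=0}^\infty\epsilon_j\left(\frac{\eta\psi^2}{8}\right)^j\cos(2j\delta)\Bigg\{\sum_{k_1=0}^\infty\sum_{k_2=0}^\infty T_1(k_1,k_2,j;\psi,\eta)-\exp(-\beta u^2)\sum_{k_1=0}^\infty\sum_{k_2=0}^\infty\ \sum_{k=1}^{\ell_{k_1,k_2}^{(j)}+1}T_2(u,k_1,k_2,j,k;\psi,\eta)\Bigg\}$$ for $u>0$, and $F_R(u;\boldsymbol\mu,\boldsymbol\Sigma)=0$ for $u\le0$.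
   Context: $\epsilon_0=1$ and $\epsilon_j=2$ for $j\ge1$. The constants are $$\alpha=\frac{1}{\sigma_1\sigma_2\sqrt{1-\rho^2}}\exp\left(-\frac{\mu_1^2\sigma_2^2+\sigma_1^2\mu_2^2-2\rho\sigma_1\sigma_2\mu_1\mu_2}{2\sigma_1^2\sigma_2^2(1-\rho^2)}\right),\qquad \beta=\frac{\sigma_1^2+\sigma_2^2}{4\sigma_1^2\sigma_2^2(1-\rho^2)},$$ $$\eta=\frac{\sqrt{(\sigma_2^2-\sigma_1^2)^2+4\sigma_1^2\sigma_2^2\rho^2}}{4\sigma_1^2\sigma_2^2(1-\rho^2)},\qquad \psi=\frac{\sqrt{\sigma_1^2(\rho\mu_1\sigma_2-\mu_2\sigma_1)^2+\sigma_2^2(\rho\mu_2\sigma_1-\mu_1\sigma_2)^2}}{\sigma_1^2\sigma_2^2(1-\rho^2)},$$ and $\delta=\tilde\phi-\phi/2$, where the angles $\tilde\phi,\phi$ satisfy $$\cos\tilde\phi=\frac{\mu_2\sigma_1^2-\rho\mu_1\sigma_1\sigma_2}{D},\quad \sin\tilde\phi=\frac{\mu_1\sigma_2^2-\rho\mu_2\sigma_1\sigma_2}{D},\quad D=\sqrt{\mu_1^2\sigma_2^4+\mu_2^2\sigma_1^4+\rho^2\sigma_1^2\sigma_2^2(\mu_1^2+\mu_2^2)-2\rho\mu_1\mu_2\sigma_1\sigma_2(\sigma_1^2+\sigma_2^2)},$$ $$\cos\phi=\frac{\sigma_2^2-\sigma_1^2}{\sqrt{(\sigma_1^2-\sigma_2^2)^2+4\rho^2\sigma_1^2\sigma_2^2}},\quad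 \sin\phi=\frac{2\rho\sigma_1\sigma_2}{\sqrt{(\sigma_1^2-\sigma_2^2)^2+4\rho^2\sigma_1^2\sigma_2^2}}.$$ If the denominator in the definition of $\tilde\phi$ (i.e. $\psi=0$) or of $\phi$ (i.e. $\eta=0$) vanishes, the corresponding angle is arbitrary. For nonnegative integers $k_1,k_2,j$ put $\ell_{k_1,k_2}^{(j)}=k_1+2k_2+2j$, write $(n)_{(l)}=n!/(n-l)!$ for the falling factorial, and set $$C(k_1,k_2,j;\psi,\eta)=\frac{\psi^{2k_1}\eta^{2k_2}}{4^{k_1+k_2}k_1!\,(k_1+2j)!\,k_2!\,(k_2+j)!},$$ $$T_1(k_1,k_2,j;\psi,\eta)=C(k_1,k_2,j;\psi,\eta)\frac{\ell_{k_1,k_2}^{(j)}!}{\beta^{\ell_{k_1,k_2}^{(j)}}},$$ $$T_2(u,k_1,k_2,j,k;\psi,\eta)=C(k_1,k_2,j;\psi,\eta)\frac{(\ell_{k_1,k_2}^{(j)})_{(k-1)}}{\beta^{k-1}}u^{2\ell_{k_1,k_2}^{(j)}+2-2k}.$$ Conventions: $0^0=1$. *)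

(* Defs.v *)
From HB Require Import structures.
From mathcomp Require Import all_boot all_order all_algebra.
From mathcomp Require Import all_classical all_reals all_analysis.
From mathcomp Require Import measurable_realfun.
Set Implicit Arguments.
Unset Strict Implicit.
Unset Printing Implicit Defensive.
Import Order.TTheory GRing.Theory Num.Theory.
Import numFieldNormedType.Exports.
Local Open Scope classical_set_scope.
Local Open Scope ring_scope.

Definition colvec2 (R : realType) (a b : R) : 'cV[R]_2 :=
  \col_i (if i == 0 then a else b).

Definition cov2 (R : realType) (s1 s2 rho : R) : 'M[R]_2 :=
  \matrix_(i, j) (if i == j then (if i == 0 then s1 ^+ 2 else s2 ^+ 2)
                  else rho * s1 * s2).

Definition normal2_pdf (R : realType) (m : 'cV[R]_2) (S : 'M[R]_2)
    (x : R * R) : R :=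
  let v := colvec2 x.1 x.2 - m in
  (2 * pi * Num.sqrt (\det S))^-1 * expR (- (v^T *m invmx S *m v) 0 0 / 2).

(* X ~ N_2(m, S), via its Lebesgue density: meaningful only for positive
   definite S, which is the only case in which it is used. *)
Definition is_normal2 (d : measure_display) (T : measurableType d)
    (R : realType) (P : probability T R)
    (X : {RV P >-> (R * R)%type})
    (m : 'cV[R]_2) (S : 'M[R]_2) : Prop :=
  forall A : set (R * R), measurable A ->
    distribution P X A =
    (\int[(@lebesgue_measure R \x @lebesgue_measure R)]_(x in A)
       (normal2_pdf m S x)%:E)%E.

Definition enorm2 (R : realType) (x : R * R) : R :=
  Num.sqrt (x.1 ^+ 2 + x.2 ^+ 2).

Lemma measurable_enorm2 (R : realType) : measurable_fun [set: _] (@enorm2 R).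
Proof.
apply: (measurableT_comp (f := @Num.sqrt R)).
  exact: continuous_measurable_fun (@sqrt_continuous R).
apply: measurable_funD; apply: measurable_funX.
- exact: measurable_fst.
- exact: measurable_snd.
Qed.

HB.instance Definition _ (R : realType) :=
  isMeasurableFun.Build _ _ _ _ (@enorm2 R) (@measurable_enorm2 R).

Definition enorm_rv (d : measure_display) (T : measurableType d)
    (R : realType) (P : probability T R)
    (X : {RV P >-> (R * R)%type}) :
  {RV P >-> R} := (@enorm2 R \o X : {mfun T >-> R}).

Definition alphac (R : realType) (mu1 mu2 s1 s2 rho : R) : R :=
  (s1 * s2 * Num.sqrt (1 - rho ^+ 2))^-1 *
  expR (- ((mu1 ^+ 2 * s2 ^+ 2 + s1 ^+ 2 * mu2 ^+ 2
            - 2 * rho * s1 * s2 * mu1 * mu2)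
           / (2 * s1 ^+ 2 * s2 ^+ 2 * (1 - rho ^+ 2)))).

Definition betac (R : realType) (s1 s2 rho : R) : R :=
  (s1 ^+ 2 + s2 ^+ 2) / (4 * s1 ^+ 2 * s2 ^+ 2 * (1 - rho ^+ 2)).

Definition etac (R : realType) (s1 s2 rho : R) : R :=
  Num.sqrt ((s2 ^+ 2 - s1 ^+ 2) ^+ 2 + 4 * s1 ^+ 2 * s2 ^+ 2 * rho ^+ 2)
  / (4 * s1 ^+ 2 * s2 ^+ 2 * (1 - rho ^+ 2)).

Definition psic (R : realType) (mu1 mu2 s1 s2 rho : R) : R :=
  Num.sqrt (s1 ^+ 2 * (rho * mu1 * s2 - mu2 * s1) ^+ 2
            + s2 ^+ 2 * (rho * mu2 * s1 - mu1 * s2) ^+ 2)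
  / (s1 ^+ 2 * s2 ^+ 2 * (1 - rho ^+ 2)).

(* cos a = c / q and sin a = s / q; no constraint on a when q = 0. *)
Definition is_angle (R : realType) (c s q a : R) : Prop :=
  q != 0 -> cos a = c / q /\ sin a = s / q.

Definition is_phitilde (R : realType) (mu1 mu2 s1 s2 rho a : R) : Prop :=
  is_angle (mu2 * s1 ^+ 2 - rho * mu1 * s1 * s2)
           (mu1 * s2 ^+ 2 - rho * mu2 * s1 * s2)
           (Num.sqrt (mu1 ^+ 2 * s2 ^+ 4 + mu2 ^+ 2 * s1 ^+ 4
              + rho ^+ 2 * s1 ^+ 2 * s2 ^+ 2 * (mu1 ^+ 2 + mu2 ^+ 2)
              - 2 * rho * mu1 * mu2 * s1 * s2 * (s1 ^+ 2 + s2 ^+ 2)))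
           a.

Definition is_phi (R : realType) (s1 s2 rho a : R) : Prop :=
  is_angle (s2 ^+ 2 - s1 ^+ 2)
           (2 * rho * s1 * s2)
           (Num.sqrt ((s1 ^+ 2 - s2 ^+ 2) ^+ 2
              + 4 * rho ^+ 2 * s1 ^+ 2 * s2 ^+ 2))
           a.

Definition epsj (R : realType) (j : nat) : R := if j == 0%N then 1 else 2.

Definition ell (k1 k2 j : nat) : nat := (k1 + 2 * k2 + 2 * j)%N.

Definition Ccoef (R : realType) (psi eta : R) (k1 k2 j : nat) : R :=
  psi ^+ (2 * k1) * eta ^+ (2 * k2)
  / (4 ^+ (k1 + k2) * k1`!%:R * (k1 + 2 * j)`!%:R * k2`!%:R * (k2 + j)`!%:R).

Definition T1 (R : realType) (beta psi eta : R) (k1 k2 j : nat) : R :=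
  Ccoef psi eta k1 k2 j * ((ell k1 k2 j)`!%:R / beta ^+ ell k1 k2 j).

(* The subtractions on nat are exact for 1 <= k <= ell k1 k2 j + 1, the range
   over which T2 is summed. *)
Definition T2 (R : realType) (beta u psi eta : R) (k1 k2 j k : nat) : R :=
  Ccoef psi eta k1 k2 j * ((ell k1 k2 j ^_ (k - 1))%:R / beta ^+ (k - 1))
  * u ^+ (2 * ell k1 k2 j + 2 - 2 * k).

(* limn takes a junk value on divergent sequences, hence the companion
   convergence predicate. *)
Definition dseries (R : realType) (a : nat -> nat -> R) : R :=
  limn (series (fun k1 => limn (series (a k1)))).

Definition dseries_cvg (R : realType) (a : nat -> nat -> R) : Prop :=
  (forall k1, cvgn (series (a k1))) /\
  cvgn (series (fun k1 => limn (series (a k1)))).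

(* Main.v *)
Require Import Defs.
From HB Require Import structures.
From mathcomp Require Import all_boot all_order all_algebra.
From mathcomp Require Import all_classical all_reals all_analysis.
From mathcomp Require Import measurable_realfun.
From mathcomp Require Import ring lra zify.
Import Order.TTheory GRing.Theory Num.Theory.
Import numFieldNormedType.Exports.
Local Open Scope classical_set_scope.
Local Open Scope ring_scope.

(** In polar coordinates, the quadratic form in the exponent of the normal density
    splits into its isotropic part [beta r^2], a trace-free part [eta r^2] times
    the cosine of twice the angle, and the linear part is [psi r] times a cosine
    of the angle ([normal2_pdf_polar]).  The mass of the disc of radius [u] is
    therefore the integral over [0 < r <= u] of
      [alpha / (2 pi) * r * exp(- beta r^2)]
    times the integral over a full turn of
      [exp(psi r cos(t + c1) + eta r^2 cos(2 t + c2))],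
    where [2 c1 - c2 = 2 delta] ([cdf_enorm_polar]).

    Expanding both exponentials into Fourier series whose coefficients are the
    modified Bessel functions [I_n] (the Jacobi-Anger expansion [jacobi_anger]),
    orthogonality of the cosines gives for the integral over the turn
      [2 pi * sum_j epsj j * I_(2 j)(psi r) * I_j(eta r^2) * cos(2 j delta)],
    which is [angular_integral_cvg].  The power series of the two Bessel functions
    multiply to [(eta psi^2 / 8)^j] times the double series with coefficients
    [Ccoef] and monomials [r^(2 ell)].  Integrated against [r exp(- beta r^2)] up
    to [u], each monomial gives an incomplete Gamma value [inc_gamma], whose closed
    form turns its product with [Ccoef] into [T1] minus [exp(- beta u^2)] times
    the sum of the terms [T2] ([integral_bessel_product]).  Convergence of the double series rests on
    [eta < beta], which is the positivity of the determinant of the covariance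
    matrix ([etac_lt_betac], [T1_summable]).

    All exchanges of sums and integrals are made between nonnegative extended
    reals: a cosine always occurs as [1 + cos], and the contribution of the
    constant 1, which is finite, is subtracted at the end. *)

(** * Polar coordinates through linear substitutions *)

Section Scaling.
Context {R : realType}.
Local Notation mu := (@lebesgue_measure R).
Local Open Scope ereal_scope.

(** Both sides are measures that agree on half-open intervals. *)
Lemma lebesgue_measure_scale (c : R) (A : set R) : (0 < c)%R -> measurable A ->
  mu A = c%:E * mu ( *%R c @^-1` A).
Proof.
move=> c0 mA.
have mc : measurable_fun setT ( *%R c : measurableTypeR R -> measurableTypeR R).
  exact: measurable_funM.
(* The right-hand side is bundled as a measure so that the uniqueness theorem
   applies to it. *)
have [nu nuE] : exists nu : {measure set (measurableTypeR R) -> \bar R},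
    forall B, nu B = c%:E * mu ( *%R c @^-1` B).
  unshelve eexists.
    unshelve refine (mscale (NngNum (ltW c0)) (pushforward mu
      ( *%R c : measurableTypeR R -> measurableTypeR R))).
    exact: mc.
  by [].
rewrite -nuE; apply: lebesgue_measure_unique => //= _ [[a b]] _ <-.
rewrite nuE.
rewrite (_ : _ @^-1` _ = `](a / c)%R, (b / c)%R]%classic); last first.
  apply/seteqP; split => x /=; rewrite !in_itv/= ltr_pdivrMr// ler_pdivlMr// mulrC//.
rewrite !lebesgue_measure_itv/= !lte_fin ltr_pM2r ?invr_gt0//.
case: ifPn => ab; last by rewrite mule0.
by rewrite -!EFinB -EFinM; congr EFin; field; rewrite gt_eqF.
Qed.

Lemma ge0_integral_scale (c : R) (f : R -> \bar R) : (0 < c)%R ->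
  measurable_fun setT f -> (forall x, 0 <= f x) ->
  \int[mu]_x f x = c%:E * \int[mu]_x f (c * x)%R.
Proof.
move=> c0 mf f0.
have mc : measurable_fun setT ( *%R c : measurableTypeR R -> measurableTypeR R).
  exact: measurable_funM.
have -> : \int[mu]_x f (c * x)%R = \int[pushforward mu
    ( *%R c : measurableTypeR R -> measurableTypeR R)]_x f x.
  by rewrite ge0_integral_pushforward// preimage_setT.
rewrite -(ge0_integral_mscale _ _ (NngNum (ltW c0)))//.
apply: eq_measure_integral => A mA _.
exact: lebesgue_measure_scale.
Qed.

Lemma ge0_integral_opp (D : set R) (f : R -> \bar R) : measurable D ->
  measurable_fun D f -> (forall x, 0 <= f x) ->
  \int[mu]_(x in D) f x = \int[mu]_(x in -%R @^-1` D) f (- x)%R.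
Proof.
move=> mD mf f0.
have mc : measurable_fun setT (-%R : measurableTypeR R -> measurableTypeR R).
  exact: oppr_measurable.
rewrite -(ge0_integral_pushforward mc)//.
by apply: eq_measure_integral => A mA _; exact/esym/lebesgue_measureN.
Qed.

Lemma ge0_integral_fold (g : R -> \bar R) :
  measurable_fun setT g -> (forall x, 0 <= g x) ->
  \int[mu]_x g x = \int[mu]_(x in `]0%R, +oo[) (g x + g (- x)%R).
Proof.
move=> mg g0.
have mgN : measurable_fun setT (fun x : R => g (- x)%R).
  by apply: measurableT_comp => //; exact: oppr_measurable.
rewrite ge0_integralD//=; [|exact: measurable_funTS..].
rewrite -(setUv `]0%R, +oo[%classic) ge0_integral_setU//=; last 3 first.
- exact: measurableC.
- by rewrite setUv.
- by apply/disj_setPS; rewrite setICr.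
congr (_ + _); rewrite setCitvr/=.
rewrite ge0_integral_opp//; last exact: measurable_funTS.
rewrite (_ : -%R @^-1` `]-oo, 0%R]%classic = `[0%R, +oo[%classic); last first.
  by apply/seteqP; split => x /=; rewrite !in_itv/= andbT oppr_le0.
rewrite integral_itv_obnd_cbnd//.
exact: measurable_funTS.
Qed.

(** The cosine of the angle whose tangent is [s]. *)
Let cs (s : R) : R := (Num.sqrt (1 + s ^+ 2))^-1%R.

Lemma measurable_cs : measurable_fun setT cs.
Proof.
rewrite (_ : cs = cos \o atan)%R; last by apply/funext => s; rewrite /cs/= cos_atan.
apply: continuous_measurable_fun => x; apply: continuous_comp.
  exact: continuous_atan.
exact: continuous_cos.
Qed.

(** Polar coordinates, with the angle [t] in ]-pi/2, pi/2[ described by its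
    tangent [s], so that [dt = ds / (1 + s^2)], and the half-plane of negative
    abscissae folded onto the other one.  On the half-plane [x > 0], the linear
    substitutions [y = x s] for fixed [x], and [x = r cos t] for fixed [s],
    produce the Jacobian [r / (1 + s^2)]; Tonelli's theorem is used between
    them. *)
Lemma ge0_integral_polar (f : R * R -> \bar R) :
  measurable_fun setT f -> (forall z, 0 <= f z) ->
  \int[mu \x mu]_z f z = \int[mu]_(r in `]0%R, +oo[) \int[mu]_s
    ((r / (1 + s ^+ 2))%:E *
     (f (r * cs s, r * (s * cs s))%R + f (- (r * cs s), - (r * (s * cs s)))%R)).
Proof.
move=> mf f0.
pose F (z : R * R) := f z + f (- z.1, - z.2)%R.
have mF : measurable_fun setT F.
  apply: emeasurable_funD => //; apply: measurableT_comp => //.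
  by apply: measurable_fun_pair; apply: measurable_funN.
have F0 z : 0 <= F z by rewrite adde_ge0.
(* The factor [max x 0] both is the Jacobian of [y = x s] and restricts [x] to
   the positive half-line. *)
pose H (z : R * R) := (Num.max z.1 0)%:E * F (z.1, z.1 * z.2)%R.
have mH : measurable_fun setT H.
  apply: emeasurable_funM.
    by apply/measurable_EFinP; apply: measurable_maxr.
  apply: measurableT_comp => //.
  by apply: measurable_fun_pair => //; apply: measurable_funM.
have H0 z : 0 <= H z by rewrite mule_ge0// lee_fin le_max lexx orbT.
have Hle0 x s : (x <= 0)%R -> H (x, s) = 0 by move=> x0; rewrite /H/= max_r// mul0e.
(* [H] after the substitution [x = r cos t]. *)
pose K (z : R * R) := (cs z.2)%:E * H (z.1 * cs z.2, z.2)%R.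
have cs0 s : (0 < cs s)%R by rewrite /cs invr_gt0 sqrtr_gt0 ltr_pwDl ?sqr_ge0.
have K0 z : 0 <= K z by rewrite mule_ge0// lee_fin ltW.
have mcs2 : measurable_fun setT (fun z : R * R => cs z.2).
  by apply: measurableT_comp => //; exact: measurable_cs.
have mK : measurable_fun setT K.
  apply: emeasurable_funM; first exact/measurable_EFinP.
  apply: measurableT_comp => //.
  by apply: measurable_fun_pair => //; apply: measurable_funM.
have sectx (G : R * R -> \bar R) x : measurable_fun setT G ->
    measurable_fun setT (fun y => G (x, y)).
  by move=> mG; apply: measurableT_comp.
have secty (G : R * R -> \bar R) y : measurable_fun setT G ->
    measurable_fun setT (fun x => G (x, y)).
  by move=> mG; apply: measurableT_comp.
rewrite fubini_tonelli1// /fubini_F.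
rewrite ge0_integral_fold; last 2 first.
- exact: measurable_fun_fubini_tonelli_F.
- by move=> x; exact: integral_ge0.
have step x : (0 < x)%R ->
  \int[mu]_y f (x, y) + \int[mu]_y f (- x, y)%R = \int[mu]_s H (x, s).
  move=> x0.
  rewrite [X in _ + X]ge0_integral_opp//; last exact: sectx.
  rewrite preimage_setT -ge0_integralD//; last 2 first.
  - exact: sectx.
  - apply: (measurableT_comp (f := f)) => //.
    by apply: measurable_fun_pair => //; exact: oppr_measurable.
  rewrite (@ge0_integral_scale x (fun y => f (x, y) + f (- x, - y)%R))//; last 2 first.
  - exact: (sectx F).
  - by move=> y; exact: (F0 (x, y)).
  rewrite -ge0_integralZl//; last 3 first.
  - apply: (measurableT_comp (f := fun y => f (x, y) + f (- x, - y)%R)).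
      exact: (sectx F).
    exact: mulrl_measurable.
  - by move=> y _; exact: (F0 (x, x * y)%R).
  - by rewrite lee_fin ltW.
  by apply: eq_integral => y _; rewrite /H/= max_l// ltW.
under eq_integral => x.
  rewrite inE/= in_itv/= andbT => x0.
  rewrite step//.
  over.
have res (G : R * R -> \bar R) : (forall x s, (x <= 0)%R -> G (x, s) = 0) ->
  \int[mu]_(x in `]0%R, +oo[) \int[mu]_s G (x, s) = \int[mu]_x \int[mu]_s G (x, s).
  move=> G0; rewrite integral_mkcond; apply: eq_integral => x _.
  rewrite patchE; case: ifPn => //; rewrite notin_setE/= in_itv/= andbT => /negP.
  by rewrite -leNgt => x0; rewrite integral0_eq// => s _; rewrite G0.
transitivity (\int[mu]_x \int[mu]_s H (x, s)); first exact: (res H Hle0).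
rewrite (@fubini_tonelli _ _ _ _ _ mu mu H mH H0).
under eq_integral => s _.
  rewrite (@ge0_integral_scale (cs s))//; last exact: secty.
  rewrite -ge0_integralZl//; last 2 first.
  - apply: (measurableT_comp (f := fun x => H (x, s))); first exact: secty.
    exact: mulrl_measurable.
  - by rewrite lee_fin ltW.
  rewrite (_ : (fun _ => _) = (fun x => K (x, s))); last first.
    by apply/funext => x; rewrite /K/= mulrC.
  over.
transitivity (\int[mu]_x \int[mu]_s K (x, s)).
  by rewrite (@fubini_tonelli _ _ _ _ _ mu mu K mK K0).
rewrite -(res K); last first.
  move=> x s x0; rewrite /K/= Hle0 ?mule0//.
  by rewrite pmulr_lle0.
apply: eq_integral => r; rewrite inE/= in_itv/= andbT => r0.
apply: eq_integral => s _.
rewrite /K/H/F/= max_l; last by rewrite mulr_ge0// ltW.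
rewrite muleA -EFinM; congr (_%:E * (f (_, _) + f (_, _))).
- rewrite mulrCA -expr2 /cs exprVn sqr_sqrtr// addr_ge0// sqr_ge0//.
- by rewrite -mulrA (mulrC (cs s)).
- by rewrite -mulrA (mulrC (cs s)).
Qed.
End Scaling.

(** * Nonnegative double series and Bessel functions *)

Section Nneseries.
Context {R : realType}.
Local Open Scope ereal_scope.
Implicit Types (b : nat -> \bar R) (a : nat -> nat -> \bar R).

Lemma nneseries_EFin (u : nat -> R) (l : R) :
  series u @ \oo --> l -> \sum_(k <oo) (u k)%:E = l%:E.
Proof.
move=> ul; apply/cvg_lim => //.
under eq_fun do rewrite sumEFin.
by apply: cvg_EFin => //; exact: nearW.
Qed.

Lemma nneseries_lty_cvg (u : nat -> R) : (forall k, (0 <= u k)%R) ->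
  \sum_(k <oo) (u k)%:E < +oo ->
  cvgn (series u) /\ \sum_(k <oo) (u k)%:E = (limn (series u))%:E.
Proof.
move=> u0 su; suff cu : cvgn (series u) by split=> //; exact: nneseries_EFin.
have fin : \sum_(k <oo) (u k)%:E \is a fin_num.
  by rewrite ge0_fin_numE// nneseries_ge0// => k _ _; rewrite lee_fin.
apply: nondecreasing_is_cvgn.
  by apply: nondecreasing_series => k _ _; exact: u0.
exists (fine (\sum_(k <oo) (u k)%:E)) => _ [N _ <-].
rewrite -lee_fin fineK// /series/= -sumEFin.
by apply: nneseries_lim_ge => k _ _; rewrite lee_fin.
Qed.

Lemma nneseries_tail b k : (forall i, 0 <= b i) ->
  \sum_(i <oo) b i = \sum_(0 <= i < k) b i + \sum_(i <oo) b (i + k)%N.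
Proof. by move=> b0; rewrite (nneseries_split 0 k)// nneseries_addn// add0n. Qed.

(** Padding a series with zeros lets both summation ranges of a double series
    be exchanged without dependency on the outer index. *)
Lemma nneseries_shift b k : (forall i, 0 <= b i) ->
  \sum_(i <oo) (if (k <= i)%N then b (i - k)%N else 0) = \sum_(i <oo) b i.
Proof.
move=> b0; rewrite (nneseries_tail _ k)//; last by move=> i; case: ifP.
rewrite big_nat big1 ?add0e//; last first.
  by move=> i /= ik; rewrite leqNgt ik.
by apply: eq_eseriesr => i _; rewrite leq_addl addnK.
Qed.

Lemma nneseries_antidiag a : (forall p q, 0 <= a p q) ->
  \sum_(p <oo) \sum_(q <oo) a p q =
  \sum_(m <oo) \sum_(0 <= k < m.+1) a k (m - k)%N.
Proof.
move=> a0.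
under eq_eseriesr => p _ do rewrite -(nneseries_shift _ p)//.
rewrite nneseries_interchange; last by move=> p m; case: ifP.
apply: eq_eseriesr => m _.
rewrite (nneseries_tail _ m.+1); last by move=> i; case: ifP.
rewrite [X in _ + X]eseries0 ?adde0; last first.
  by move=> i _ _; rewrite ifF//; apply/negbTE; rewrite -ltnNge addnS ltnS leq_addl.
rewrite big_nat [RHS]big_nat; apply: eq_bigr => i /=; rewrite ltnS => ->//.
Qed.

(** The pairs are grouped by [|p - q|]; the diagonal occurs once and every other
    gap twice, which is where the weights [epsj] come from. *)
Lemma nneseries_gap a : (forall p q, 0 <= a p q) -> (forall p q, a p q = a q p) ->
  \sum_(p <oo) \sum_(q <oo) a p q =
  \sum_(n <oo) (epsj R n)%:E * \sum_(k <oo) a k (k + n)%N.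
Proof.
move=> a0 aC.
have s0 n : 0 <= \sum_(k <oo) a k (k + n)%N by apply: nneseries_ge0.
transitivity (\sum_(n <oo) \sum_(k <oo) a k (k + n)%N +
              \sum_(n <oo) \sum_(k <oo) a k (k + n.+1)%N).
  rewrite (@nneseries_interchange R (fun n k => a k (k + n)%N) xpredT xpredT)//.
  transitivity (\sum_(p <oo) (\sum_(n <oo) a p (p + n)%N +
     \sum_(q <oo) if (q < p)%N then a p q else 0)).
    apply: eq_eseriesr => p _; rewrite (nneseries_tail _ p)// addeC; congr (_ + _).
      by apply: eq_eseriesr => i _; rewrite addnC.
    rewrite (nneseries_tail _ p); last by move=> i; case: ifP.
    rewrite [X in _ = _ + X]eseries0 ?adde0; last first.
      by move=> i _ _; rewrite ltnNge leq_addl.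
    by rewrite big_nat [RHS]big_nat; apply: eq_bigr => i /= ->.
  rewrite nneseriesD; last 2 first.
  - by move=> p _ _; apply: nneseries_ge0.
  - by move=> p _ _; apply: nneseries_ge0 => q _ _; case: ifP.
  congr (_ + _).
  rewrite (@nneseries_interchange R (fun p q => if (q < p)%N then a p q else 0) xpredT xpredT); last by move=> p q; case: ifP.
  rewrite [RHS](@nneseries_interchange R (fun n k => a k (k + n.+1)%N) xpredT xpredT)//.
  apply: eq_eseriesr => q _.
  rewrite (nneseries_tail _ q.+1); last by move=> i; case: ifP.
  rewrite big_nat big1 ?add0e; last first.
    by move=> i /=; rewrite ltnS leqNgt => /negbTE ->.
  apply: eq_eseriesr => i _; rewrite -addSnnS ifT; last by rewrite addSn ltnS leq_addl.
  by rewrite aC addnC.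
pose F n := \sum_(k <oo) a k (k + n)%N.
rewrite [RHS](nneseries_tail (fun n => (epsj R n)%:E * F n) 1); last first.
  by move=> n; rewrite mule_ge0 ?s0// lee_fin /epsj; case: ifP.
rewrite (nneseries_tail F 1)// !big_nat1 /epsj/= mul1e -addeA; congr (_ + _).
under [X in _ + X]eq_eseriesr => n _ do rewrite -addn1.
rewrite -nneseriesD//; last by move=> n _ _; exact: s0.
by apply: eq_eseriesr => n _; rewrite addn1/= mule_natl mule2n.
Qed.

End Nneseries.

Section JacobiAnger.
Context {R : realType}.
Local Notation e := (@exp_coeff R).

(** The real part of [(exp(i x) + exp(- i x))^m exp(i c) = (2 cos x)^m exp(i c)],
    with the binomial theorem on the left.  The phase [c] makes a direct
    induction possible: Pascal's rule turns the sum at rank [m + 1] into those at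
    rank [m] with phases [c - x] and [c + x]. *)
Lemma cos_binomial (m : nat) (x c : R) :
  \sum_(0 <= k < m.+1) 'C(m, k)%:R * cos ((k%:R - (m - k)%:R) * x + c) =
  2 ^+ m * cos x ^+ m * cos c.
Proof.
elim: m c => [|m IH] c; first by rewrite big_nat1 subrr mul0r add0r !expr0 bin0 !mul1r.
pose f k := cos (((2 * k)%:R - m.+1%:R) * x + c).
rewrite (eq_big_nat _ _ (F2 := fun k => 'C(m.+1, k)%:R * f k)); last first.
  move=> k; rewrite /= ltnS => km; rewrite natrB// /f; congr (_ * cos _).
  by rewrite natrM; ring.
have -> : \sum_(0 <= k < m.+2) 'C(m.+1, k)%:R * f k =
    \sum_(0 <= k < m.+1) 'C(m, k)%:R * f k + \sum_(0 <= k < m.+1) 'C(m, k)%:R * f k.+1.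
  have -> : \sum_(0 <= k < m.+1) 'C(m, k)%:R * f k =
            \sum_(0 <= k < m.+2) 'C(m, k)%:R * f k.
    by rewrite [RHS]big_nat_recr//= bin_small// mul0r addr0.
  rewrite big_nat_recl// [in RHS]big_nat_recl// !bin0 -addrA; congr (_ + _).
  by rewrite -big_split/=; apply: eq_bigr => k _; rewrite binS natrD mulrDl.
rewrite (eq_big_nat _ _ (F2 := fun k => 'C(m, k)%:R *
    cos ((k%:R - (m - k)%:R) * x + (c - x)))); last first.
  move=> k; rewrite /= ltnS => km; rewrite natrB// /f; congr (_ * cos _).
  by rewrite natrM -natr1; ring.
rewrite IH (eq_big_nat _ _ (F2 := fun k => 'C(m, k)%:R *
    cos ((k%:R - (m - k)%:R) * x + (c + x)))); last first.
  move=> k; rewrite /= ltnS => km; rewrite natrB// /f; congr (_ * cos _).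
  by rewrite natrM -!natr1; ring.
by rewrite IH cosB cosD !exprS; ring.
Qed.

(** The exponential series at [z] and at [z y].  Adding the first one makes the
    terms nonnegative when [|y|] and [|c|] are at most 1. *)
Lemma nneseries_exp (z y c : R) :
  (\sum_(m <oo) (e z m * (1 + y ^+ m * c))%:E = (expR z + expR (z * y) * c)%:E)%E.
Proof.
apply: nneseries_EFin.
rewrite (_ : series _ = series (e z) \+ (fun n => series (e (z * y)) n * c)); last first.
  apply/funext => n; rewrite /series/= mulr_suml -big_split/=.
  by apply: eq_bigr => k _; rewrite /exp_coeff/= exprMn; field; rewrite pnatr_eq0 -lt0n fact_gt0.
apply: cvgD; first exact: is_cvg_series_exp_coeff.
by apply: cvgMl; exact: is_cvg_series_exp_coeff.
Qed.

Lemma cos1D_ge0 (x : R) : 0 <= 1 + cos x.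
Proof. by have := cos_geN1 x; lra. Qed.

(** The expansion of [exp(z cos x) = exp(z exp(i x) / 2) exp(z exp(- i x) / 2)] as
    a product of two exponential series, before the terms of equal frequency are
    collected.  Grouping along the antidiagonals [p + q = m] gives back the powers
    of [cos x] by [cos_binomial].  Every cosine is replaced by [1 + cos], so that
    all rearrangements take place between nonnegative series. *)
Lemma jacobi_anger_pairs (z x c : R) : 0 <= z ->
  (\sum_(p <oo) \sum_(q <oo)
     (e (z / 2) p * e (z / 2) q * (1 + cos ((p%:R - q%:R) * x + c)))%:E
   = (expR z + expR (z * cos x) * cos c)%:E)%E.
Proof.
move=> z0; have e0 k : 0 <= e (z / 2) k by apply: exp_coeff_ge0; rewrite divr_ge0.
rewrite nneseries_antidiag; last first.
  by move=> p q; rewrite lee_fin mulr_ge0 ?cos1D_ge0// mulr_ge0.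
rewrite -nneseries_exp; apply: eq_eseriesr => m _.
rewrite sumEFin; congr EFin.
have eE k : (k <= m)%N -> e (z / 2) k * e (z / 2) (m - k)%N = e z m / 2 ^+ m * 'C(m, k)%:R.
  move=> km; have fk (n : nat) : (n`!%:R : R) != 0 by rewrite pnatr_eq0 -lt0n fact_gt0.
  have -> : 'C(m, k)%:R = m`!%:R / (k`!%:R * (m - k)`!%:R) :> R.
    by rewrite -(bin_fact km) !natrM; field; rewrite !fk.
  rewrite /exp_coeff/= !exprMn exprVn -[in RHS](subnKC km) !exprD.
  by rewrite subnKC// exprVn; field; rewrite !fk !expf_neq0.
transitivity (\sum_(0 <= k < m.+1) (e z m / 2 ^+ m * 'C(m, k)%:R +
   e z m / 2 ^+ m * ('C(m, k)%:R * cos ((k%:R - (m - k)%:R) * x + c)))).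
  rewrite big_nat [RHS]big_nat; apply: eq_bigr => k; rewrite /= ltnS => km.
  by rewrite eE//; ring.
rewrite big_split/= -!mulr_sumr cos_binomial.
have -> : \sum_(0 <= k < m.+1) 'C(m, k)%:R = 2 ^+ m :> R.
  have := cos_binomial m 0 0; rewrite cos0 expr1n !mulr1 => <-.
  by apply: eq_bigr => k _; rewrite mulr0 addr0 cos0 mulr1.
by field; rewrite expf_neq0.
Qed.

(** The modified Bessel function of the first kind, usually written I_n. *)
Definition bessel (n : nat) (z : R) : R :=
  limn (series (fun k => e (z / 2) k * e (z / 2) (k + n)%N)).

Lemma bessel_term_ge0 (z : R) p q : 0 <= z -> 0 <= e (z / 2) p * e (z / 2) q.
Proof. by move=> z0; rewrite mulr_ge0// exp_coeff_ge0// divr_ge0. Qed.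

(** Convergence: the diagonal [q = p + n] is a part of the convergent double
    series of [jacobi_anger_pairs] at [x = c = 0]. *)
Lemma besselE n (z : R) : 0 <= z ->
  ((bessel n z)%:E = \sum_(k <oo) (e (z / 2) k * e (z / 2) (k + n)%N)%:E)%E.
Proof.
move=> z0; have a0 := @bessel_term_ge0 z.
apply/esym; refine (nneseries_lty_cvg _ _ _).2 => [k|]; first exact: a0.
have := @jacobi_anger_pairs z 0 0 z0; set S := (\sum_(p <oo) _)%E => SE.
apply: (@le_lt_trans _ _ S); last by rewrite SE ltry.
apply: lee_nneseries => [k _ _|k _]; first by rewrite lee_fin a0.
apply: le_trans (nneseries_lim_ge (k + n).+1 _); last first.
  by move=> q _ _; rewrite lee_fin mulr_ge0 ?cos1D_ge0 ?a0.
rewrite sumEFin lee_fin big_nat_recr//= ler_wpDl//.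
  by apply: sumr_ge0 => q _; rewrite mulr_ge0 ?cos1D_ge0 ?a0.
by rewrite ler_peMr ?a0// mulr0 addr0 cos0 lerDl.
Qed.

Lemma bessel_ge0 n (z : R) : 0 <= z -> 0 <= bessel n z.
Proof.
move=> z0; rewrite -lee_fin besselE//; apply: nneseries_ge0 => k _ _.
by rewrite lee_fin bessel_term_ge0.
Qed.

(** The Jacobi-Anger expansion: the terms of [jacobi_anger_pairs] of frequency
    [n] or [- n] are the [n]-th Bessel series. *)
Lemma jacobi_anger (z x : R) : 0 <= z ->
  (\sum_(n <oo) (epsj R n * bessel n z * (1 + cos (n%:R * x)))%:E
   = (expR z + expR (z * cos x))%:E)%E.
Proof.
move=> z0; have := @jacobi_anger_pairs z x 0 z0.
rewrite cos0 mulr1 => <-.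
rewrite nneseries_gap; last 2 first.
- by move=> p q; rewrite lee_fin mulr_ge0 ?cos1D_ge0// bessel_term_ge0.
- move=> p q; congr EFin.
  have -> : (q%:R - p%:R) * x + 0 = - ((p%:R - q%:R) * x + 0) by ring.
  by rewrite cosN (mulrC (e _ q)).
apply: eq_eseriesr => n _; rewrite -mulrA EFinM; congr (_ * _)%E.
rewrite EFinM besselE// muleC -nneseriesZl; last first.
  by move=> k _; rewrite lee_fin bessel_term_ge0.
apply: eq_eseriesr => k _; rewrite -EFinM mulrC; congr (_ * (1 + _))%:E.
by rewrite addr0 natrD -[LHS]cosN; congr cos; ring.
Qed.

End JacobiAnger.

(** * Averaging over the angle *)

Section Angular.
Context {R : realType}.
Local Notation mu := (@lebesgue_measure R).
Local Notation e := (@exp_coeff R).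

Lemma continuous_inv_1Dsqr : continuous (fun s : R => (1 + s ^+ 2)^-1).
Proof.
move=> s; apply: cvgV; first by rewrite gt_eqF// ltr_pwDl// sqr_ge0.
by apply: cvgD; [exact: cvg_cst|exact: exprn_continuous].
Qed.

(** The substitution [t = atan s]: the line is folded onto the half-line, where
    [Phi (atan s) - Phi (- atan s)] is a primitive that vanishes at 0. *)
Lemma integral_atan (phi Phi : R -> R) : continuous phi ->
  (forall t, 0 <= phi t) -> (forall t : R, is_derive t 1 Phi (phi t)) ->
  (\int[mu]_s ((1 + s ^+ 2)^-1 * phi (atan s))%:E =
   (Phi (pi / 2) - Phi (- (pi / 2)))%:E)%E.
Proof.
move=> cphi phi0 dPhi.
have cPhi : continuous Phi.
  by move=> t; apply/differentiable_continuous/derivable1_diffP; exact: ex_derive.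
pose g s := (1 + s ^+ 2)^-1 * phi (atan s).
have w0 (s : R) : 0 <= (1 + s ^+ 2)^-1 by rewrite invr_ge0 addr_ge0// sqr_ge0.
have cg : continuous g.
  move=> s; apply: cvgM; first exact: continuous_inv_1Dsqr.
  by apply: continuous_comp; [exact: continuous_atan|exact: cphi].
have mg : measurable_fun setT g by exact: continuous_measurable_fun.
rewrite ge0_integral_fold; last 2 first.
- exact/measurable_EFinP.
- by move=> s; rewrite lee_fin mulr_ge0.
pose f (s : R) := g s + g (- s).
have cf : continuous f.
  move=> s; apply: cvgD; first exact: cg.
  by apply: continuous_comp; [exact: opp_continuous|exact: cg].
pose F (s : R) := Phi (atan s) - Phi (- atan s).
have dF (s : R) : is_derive s 1 F (f s).
  rewrite /F /f /g atanN sqrrN.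
  apply: is_derive_eq.
  rewrite /GRing.scale/=; ring.
rewrite integral_itv_obnd_cbnd; last first.
  by apply/measurable_EFinP/measurable_funTS; exact: continuous_measurable_fun.
rewrite (@ge0_continuous_FTC2y _ f F 0 (Phi (pi / 2) - Phi (- (pi / 2)))).
- by rewrite /F atan0 oppr0 subrr sube0.
- by move=> s _; rewrite /f addr_ge0// mulr_ge0.
- exact: continuous_subspaceT.
- apply: cvgB.
    by apply: continuous_cvg; [exact: cPhi|exact: cvgy_atan].
  by apply: continuous_cvg; [exact: cPhi|apply: cvgN; exact: cvgy_atan].
- by move=> s _; exact: ex_derive.
- apply: cvg_at_right_filter.
  by apply/differentiable_continuous/derivable1_diffP; exact: ex_derive.
- by move=> s _; rewrite derive1E derive_val.
Qed.

Lemma sinD2pin (x : R) n : sin (x + n%:R * (2 * pi)) = sin x.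
Proof.
by rewrite -[RHS](periodicn (@sinD2pi R) n x) !mulr_natl.
Qed.

(** Orthogonality of the cosines.  The two half-turns starting at [atan s] and at
    [atan s + pi] make up a full period, over which a nonzero integer frequency
    averages to 0; the constant 2 makes the integrand nonnegative. *)
Lemma angle_integral (p q : nat) (c : R) :
  (\int[mu]_s ((1 + s ^+ 2)^-1 *
     (2 + cos ((p%:R - q%:R) * atan s + c)
        + cos ((p%:R - q%:R) * (atan s + pi) + c)))%:E =
  (2 * pi * (1 + (p == q)%:R * cos c))%:E)%E.
Proof.
set N : R := p%:R - q%:R.
pose phi t := 2 + cos (N * t + c) + cos (N * (t + pi) + c).
have cphi : continuous phi.
  move=> t; apply/differentiable_continuous/derivable1_diffP.
  by rewrite /phi; exact: ex_derive.
have phi0 t : 0 <= phi t.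
  have := cos_geN1 (N * t + c); have := cos_geN1 (N * (t + pi) + c).
  by rewrite /phi; lra.
have [pq|pq] := eqVneq p q.
  have N0 : N = 0 by rewrite /N pq subrr.
  have dPhi (t : R) : is_derive t 1 (fun t => (2 + 2 * cos c) * t) (phi t).
    apply: is_derive_eq.
    by rewrite /phi N0 !mul0r add0r /GRing.scale/=; ring.
  rewrite (integral_atan _ _ cphi phi0 dPhi).
  by congr EFin; rewrite mul1r; field.
have N0 : N != 0.
  by rewrite /N subr_eq0 eqr_nat.
pose Phi t := 2 * t + (sin (N * t + c) + sin (N * (t + pi) + c)) / N.
have dPhi (t : R) : is_derive t 1 Phi (phi t).
  apply: is_derive_eq.
  by rewrite /phi /GRing.scale/=; field.
rewrite (integral_atan _ _ cphi phi0 dPhi) /Phi.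
congr EFin; rewrite mul0r addr0 mulr1.
have -> : sin (N * (pi / 2 + pi) + c) = sin (N * (- (pi / 2)) + c).
  rewrite -(sinD2pin (N * (- (pi / 2)) + c) p) -(sinD2pin (N * (pi / 2 + pi) + c) q).
  by congr sin; rewrite /N; field.
have -> : - (pi / 2) + pi = pi / 2 :> R by field.
by field.
Qed.

Lemma cvg_series_delta (q0 : nat) (v : R) :
  series (fun q => (q0 == q)%:R * v) @ \oo --> v.
Proof.
apply: cvg_near_cst; near=> n; rewrite /series/=.
have nq : (q0 < n)%N by near: n; exact: nbhs_infty_gt.
rewrite (bigD1_seq q0) ?iota_uniq//= ?mem_index_iota// eqxx mul1r big1 ?addr0//.
by move=> q; rewrite eq_sym => /negbTE ->; rewrite mul0r.
Unshelve. all: by end_near. Qed.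

Lemma cvg_series_bessel n (z : R) : 0 <= z ->
  series (fun k => e (z / 2) k * e (z / 2) (k + n)%N) @ \oo --> bessel n z.
Proof.
move=> z0; have E := besselE n z z0.
by apply: (nneseries_lty_cvg _ _ _).1 => [k|]; [exact: bessel_term_ge0|rewrite -E ltry].
Qed.

(** The double series is the product of two exponential series, in which the terms
    on the line [q = p + 2 m] have been modified; these sum up to a Bessel
    function. *)
Lemma bessel_pairs_diag (m : nat) (a c : R) : 0 <= a ->
  (\sum_(p <oo) \sum_(q <oo) (e (a / 2) p * e (a / 2) q *
     (2 * pi * (1 + (p + 2 * m == q)%:R * cos c)))%:E
   = (2 * pi * (expR a + bessel (2 * m) a * cos c))%:E)%E.
Proof.
move=> a0.
transitivity (\sum_(p <oo) (2 * pi * (e (a / 2) p * expR (a / 2) +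
    e (a / 2) p * e (a / 2) (p + 2 * m)%N * cos c))%:E)%E.
  apply: eq_eseriesr => p _; apply: nneseries_EFin.
  set v := (X in _ --> X).
  rewrite (_ : series _ = series (e (a / 2)) \* cst (2 * pi * e (a / 2) p) \+
     series (fun q => (p + 2 * m == q)%:R * (2 * pi * (e (a / 2) p * e (a / 2) (p + 2 * m)%N * cos c)))); last first.
    apply/funext => n; rewrite /series/= mulr_suml -big_split/=.
    apply: eq_bigr => q _; have [->|_] := eqVneq (p + 2 * m)%N q; rewrite /=; ring.
  rewrite (_ : v = expR (a / 2) * (2 * pi * e (a / 2) p) +
      2 * pi * (e (a / 2) p * e (a / 2) (p + 2 * m)%N * cos c)); last by rewrite /v; ring.
  apply: cvgD; last exact: cvg_series_delta.
  by apply: cvgM; [exact: is_cvg_series_exp_coeff|exact: cvg_cst].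
apply: nneseries_EFin.
rewrite (_ : series _ = (series (e (a / 2)) \* cst (2 * pi * expR (a / 2))) \+
   (series (fun k => e (a / 2) k * e (a / 2) (k + 2 * m)%N) \* cst (2 * pi * cos c))); last first.
  apply/funext => n; rewrite /series/= !mulr_suml -big_split/=.
  by apply: eq_bigr => q _; ring.
rewrite [X in _ --> X](_ : _ = expR (a / 2) * (2 * pi * expR (a / 2)) +
   bessel (2 * m) a * (2 * pi * cos c)); last first.
  have -> : expR a = expR (a / 2) * expR (a / 2) by rewrite -expRD -splitr.
  ring.
apply: cvgD; apply: cvgM; try exact: cvg_cst.
  exact: is_cvg_series_exp_coeff.
exact: cvg_series_bessel.
Qed.

(** The [2 m]-th Fourier coefficient of [exp(a cos)].  In the expansion
    [jacobi_anger_pairs] of [k] at both angles, the frequency of the term [(p, q)]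
    is [p - q + 2 m], so that [angle_integral] keeps the terms [q = p + 2 m]
    only, and their phase is [- m (2 c1 - c2)]. *)
Lemma bessel_angle (m : nat) (a c1 c2 : R) (k : R -> R) : 0 <= a ->
  (forall t, k t = expR a + expR (a * cos (t + c1)) * cos (m%:R * (2 * t + c2))) ->
  (\int[mu]_s ((1 + s ^+ 2)^-1 * (k (atan s) + k (atan s + pi)))%:E =
   (2 * pi * (expR a + bessel (2 * m) a * cos (m%:R * (2 * c1 - c2))))%:E)%E.
Proof.
move=> a0 kE; rewrite -bessel_pairs_diag//.
pose C p q := (p%:R - q%:R) * c1 + m%:R * c2.
pose w p q := e (a / 2) p * e (a / 2) q.
pose f p q (t : R) := w p q * (1 + cos (((p + 2 * m)%:R - q%:R) * t + C p q)).
have w0 p q : 0 <= w p q by exact: bessel_term_ge0.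
have f0 p q t : 0 <= f p q t by rewrite mulr_ge0// cos1D_ge0.
have kf t : (\sum_(p <oo) \sum_(q <oo) (f p q t)%:E = (k t)%:E)%E.
  rewrite kE -jacobi_anger_pairs//; apply: eq_eseriesr => p _; apply: eq_eseriesr => q _.
  by congr (_ * (1 + cos _))%:E; rewrite /C natrD natrM; ring.
pose g p q (s : R) := (1 + s ^+ 2)^-1 * (f p q (atan s) + f p q (atan s + pi)).
have v0 (s : R) : 0 <= (1 + s ^+ 2)^-1 by rewrite invr_ge0 addr_ge0// sqr_ge0.
have g0 p q s : 0 <= g p q s by rewrite mulr_ge0// addr_ge0.
have cf p q : continuous (f p q).
  move=> t; apply/differentiable_continuous/derivable1_diffP.
  by rewrite /f; exact: ex_derive.
have mg p q : measurable_fun setT (EFin \o g p q).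
  have cg : continuous (g p q).
    move=> s; apply: cvgM; first exact: continuous_inv_1Dsqr.
    apply: cvgD.
      by apply: (@continuous_comp _ _ _ atan (f p q)); [exact: continuous_atan|exact: cf].
    apply: (@continuous_comp _ _ _ (fun s => atan s + pi) (f p q)); last exact: cf.
    by apply: cvgD; [exact: continuous_atan|exact: cvg_cst].
  by apply/measurable_EFinP; exact: continuous_measurable_fun.
transitivity (\int[mu]_s \sum_(p <oo) \sum_(q <oo) (g p q s)%:E)%E.
  apply: eq_integral => s _; rewrite EFinM EFinD -!kf -nneseriesD; last 2 first.
  - by move=> p _ _; apply: nneseries_ge0 => q _ _; rewrite lee_fin.
  - by move=> p _ _; apply: nneseries_ge0 => q _ _; rewrite lee_fin.
  rewrite -nneseriesZl; last first.
    by move=> p _; rewrite adde_ge0// nneseries_ge0// => q _ _; rewrite lee_fin.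
  apply: eq_eseriesr => p _; rewrite -nneseriesD; last 2 first.
  - by move=> q _ _; rewrite lee_fin.
  - by move=> q _ _; rewrite lee_fin.
  by rewrite -nneseriesZl// => q _; rewrite -EFinD lee_fin addr_ge0.
rewrite integral_nneseries//=; last 2 first.
- by move=> p; apply: ge0_emeasurable_sum => [q s _ _|q _]; [rewrite lee_fin|exact: mg].
- by move=> p s _; apply: nneseries_ge0 => q _ _; rewrite lee_fin.
apply: eq_eseriesr => p _; rewrite integral_nneseries//; last 2 first.
- by move=> q; exact: mg.
- by move=> q s _; rewrite lee_fin.
apply: eq_eseriesr => q _.
transitivity (\int[mu]_s ((w p q)%:E * ((1 + s ^+ 2)^-1 *
     (2 + cos (((p + 2 * m)%:R - q%:R) * atan s + C p q)
        + cos (((p + 2 * m)%:R - q%:R) * (atan s + pi) + C p q)))%:E))%E.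
  by apply: eq_integral => s _; rewrite -EFinM /g /f; congr EFin; ring.
rewrite ge0_integralZl_EFin//; last 2 first.
- by move=> s _; rewrite lee_fin mulr_ge0.
- pose psi t := 2 + cos (((p + 2 * m)%:R - q%:R) * t + C p q)
                   + cos (((p + 2 * m)%:R - q%:R) * (t + pi) + C p q).
  have cpsi : continuous psi.
    move=> t; apply/differentiable_continuous/derivable1_diffP.
    by rewrite /psi; exact: ex_derive.
  apply/measurable_EFinP; apply: continuous_measurable_fun => s.
  apply: cvgM; first exact: continuous_inv_1Dsqr.
  by apply: (@continuous_comp _ _ _ atan psi); [exact: continuous_atan|exact: cpsi].
rewrite angle_integral -EFinM; congr EFin.
have [<-|_] := eqVneq (p + 2 * m)%N q; last by rewrite !mul0r.
rewrite /C -[cos (m%:R * _)]cosN; congr (_ * (_ * (_ + _ * cos _))).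
by rewrite natrD natrM; ring.
Qed.

End Angular.

(** * Fourier expansion of the angular integral *)

Section AngularSeries.
Context {R : realType}.
Local Notation mu := (@lebesgue_measure R).

Lemma epsj_gt0 n : 0 < epsj R n. Proof. by rewrite /epsj; case: ifP. Qed.

Lemma cvg_jacobi_anger (z x : R) : 0 <= z ->
  series (fun n => epsj R n * bessel n z * (1 + cos (n%:R * x))) @ \oo -->
  expR z + expR (z * cos x).
Proof.
move=> z0; have E := jacobi_anger z x z0.
have u0 k : 0 <= epsj R k * bessel k z * (1 + cos (k%:R * x)).
  by rewrite !mulr_ge0 ?cos1D_ge0 ?bessel_ge0// ltW// epsj_gt0.
have [cu] := nneseries_lty_cvg _ u0 (eq_ind_r (fun t => t < +oo)%E (ltry _) E).
by rewrite E => -[->].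
Qed.

Lemma cvg_bessel_sum (z : R) : 0 <= z ->
  series (fun n => epsj R n * bessel n z) @ \oo --> expR z.
Proof.
move=> z0; have := cvg_jacobi_anger z 0 z0.
rewrite cos0 mulr1 -[X in _ --> X -> _]mulr2n -mulr_natl => h.
rewrite (_ : series _ = (fun n => 2^-1 * series (fun n => epsj R n * bessel n z * (1 + cos (n%:R * 0))) n)).
  rewrite [X in _ --> X](_ : _ = 2^-1 * (2 * expR z)); last by field.
  by apply: cvgM => //; exact: cvg_cst.
apply/funext => n; rewrite /series/= mulr_sumr; apply: eq_bigr => k _.
by rewrite mulr0 cos0; field.
Qed.

(** The factor of the normal density on the circle of radius [r] that depends on
    the angle, with [a = psi r] and [b = eta r^2]. *)
Definition angular_exp (a b c1 c2 t : R) := expR (a * cos (t + c1) + b * cos (2 * t + c2)).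

Lemma continuous_angular_exp (a b c1 c2 : R) : continuous (angular_exp a b c1 c2).
Proof.
move=> t; apply/differentiable_continuous/derivable1_diffP.
by rewrite /angular_exp; exact: ex_derive.
Qed.

(** The integral of [angular_exp] over a full turn, with the tangent of the angle as
    the variable. *)
Definition angular_integral (a b c1 c2 : R) : \bar R :=
  (\int[mu]_s ((1 + s ^+ 2)^-1 * (angular_exp a b c1 c2 (atan s)
    + angular_exp a b c1 c2 (atan s + pi)))%:E)%E.

Lemma measurable_atan_weight (f : R -> R) : continuous f ->
  measurable_fun setT (fun s : R => ((1 + s ^+ 2)^-1 * (f (atan s) + f (atan s + pi)))%:E).
Proof.
move=> cf; apply/measurable_EFinP; apply: continuous_measurable_fun => s.
apply: cvgM; first exact: continuous_inv_1Dsqr.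
apply: cvgD.
  by apply: (@continuous_comp _ _ _ atan f); [exact: continuous_atan|exact: cf].
apply: (@continuous_comp _ _ _ (fun s => atan s + pi) f); last exact: cf.
by apply: cvgD; [exact: continuous_atan|exact: cvg_cst].
Qed.

Let v0 (s : R) : 0 <= (1 + s ^+ 2)^-1.
Proof. by rewrite invr_ge0 addr_ge0// sqr_ge0. Qed.

Lemma integral_atan_cst (k : R) : 0 <= k ->
  (\int[mu]_s ((1 + s ^+ 2)^-1 * (k + k))%:E = (2 * pi * k)%:E)%E.
Proof.
move=> k0.
have dPhi (t : R) : is_derive t 1 (fun t => (k + k) * t) (k + k).
  by apply: is_derive_eq; rewrite /GRing.scale/=; ring.
rewrite (integral_atan (fun=> k + k) (fun t => (k + k) * t))//.
- by congr EFin; field.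
- by move=> t; exact: cvg_cst.
- by move=> _; rewrite addr_ge0.
Qed.

(** The Jacobi-Anger expansion of the factor [exp(b cos(2 t + c2))] alone.  The
    term of rank [m] contains the first factor and one cosine of [t], which is
    the integrand of [bessel_angle]. *)
Lemma angular_exp_sum (a b c1 c2 t : R) : 0 <= a -> 0 <= b ->
  (\sum_(m <oo) (epsj R m * bessel m b *
     (expR a + expR (a * cos (t + c1)) * cos (m%:R * (2 * t + c2))))%:E
   = (expR (a + b) + angular_exp a b c1 c2 t)%:E)%E.
Proof.
move=> a0 b0; apply: nneseries_EFin.
set E := expR (a * cos (t + c1)); set y := 2 * t + c2.
rewrite (_ : series _ = series (fun n => epsj R n * bessel n b) \* cst (expR a - E) \+
  series (fun n => epsj R n * bessel n b * (1 + cos (n%:R * y))) \* cst E); last first.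
  apply/funext => n; rewrite /series/= !mulr_suml -big_split/=.
  by apply: eq_bigr => k _; ring.
rewrite (_ : _ + angular_exp _ _ _ _ _ = expR b * (expR a - E) + (expR b + expR (b * cos y)) * E).
  apply: cvgD; apply: cvgM; try exact: cvg_cst.
    exact: cvg_bessel_sum.
  exact: cvg_jacobi_anger.
by rewrite /angular_exp !expRD -/E -/y; ring.
Qed.

Lemma angular_integral_le (a b c1 c2 : R) : 0 <= a -> 0 <= b ->
  (angular_integral a b c1 c2 <= (2 * pi * expR (a + b))%:E)%E.
Proof.
move=> a0 b0; rewrite -integral_atan_cst ?expR_ge0//.
have h t : angular_exp a b c1 c2 t <= expR (a + b).
  by rewrite ler_expR lerD// ler_piMr// cos_le1.
apply: ge0_le_integral => //.
- by move=> s _; rewrite lee_fin mulr_ge0// addr_ge0 ?expR_ge0.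
- exact: (measurable_atan_weight _ (continuous_angular_exp a b c1 c2)).
- by apply: (@measurable_atan_weight (fun=> expR (a + b))) => t; exact: cvg_cst.
- by move=> s _; rewrite lee_fin ler_wpM2l// lerD.
Qed.

Lemma angular_integral_ge0 (a b c1 c2 : R) : (0 <= angular_integral a b c1 c2)%E.
Proof.
by apply: integral_ge0 => s _; rewrite lee_fin mulr_ge0// addr_ge0 ?expR_ge0.
Qed.

Lemma angular_integral_fin (a b c1 c2 : R) : 0 <= a -> 0 <= b ->
  angular_integral a b c1 c2 \is a fin_num.
Proof.
move=> a0 b0; rewrite ge0_fin_numE ?angular_integral_ge0//.
exact: le_lt_trans (angular_integral_le _ _ _ _ a0 b0) (ltry _).
Qed.

(** The integrand of [bessel_angle]. *)
Let k (a c1 c2 : R) m t :=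
  expR a + expR (a * cos (t + c1)) * cos (m%:R * (2 * t + c2)).

Let continuous_k (a c1 c2 : R) m : continuous (k a c1 c2 m).
Proof.
move=> t; apply/differentiable_continuous/derivable1_diffP.
by rewrite /k; exact: ex_derive.
Qed.

Let k_ge0 (a c1 c2 : R) m t : 0 <= a -> 0 <= k a c1 c2 m t.
Proof.
move=> a0.
have h1 : expR (a * cos (t + c1)) <= expR a by rewrite ler_expR ler_piMr// cos_le1.
have := cos_geN1 (m%:R * (2 * t + c2)); have := expR_ge0 (a * cos (t + c1)).
rewrite /k; set X := expR (a * _) in h1 *; set Y := cos (m%:R * _) => X0 Y1.
have : 0 <= X * (1 + Y) by rewrite mulr_ge0//; lra.
by nra.
Qed.

(** It is, up to the factor [2 pi], the integral of a nonnegative function. *)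
Lemma bessel_cos_ge0 (a c1 c2 : R) m : 0 <= a ->
  0 <= expR a + bessel (2 * m) a * cos (m%:R * (2 * c1 - c2)).
Proof.
move=> a0; rewrite -(@pmulr_rge0 _ (2 * pi)); last by rewrite mulr_gt0// pi_gt0.
rewrite -lee_fin -(bessel_angle m a c1 c2 (k a c1 c2 m))//.
by apply: integral_ge0 => s _; rewrite lee_fin mulr_ge0// addr_ge0// k_ge0.
Qed.

(** Termwise integration of [angular_exp_sum] by monotone convergence. *)
Lemma angular_integral_shifted (a b c1 c2 : R) : 0 <= a -> 0 <= b ->
  ((2 * pi * expR (a + b))%:E + angular_integral a b c1 c2 =
   \sum_(m <oo) (2 * pi * (epsj R m * bessel m b) *
      (expR a + bessel (2 * m) a * cos (m%:R * (2 * c1 - c2))))%:E)%E.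
Proof.
move=> a0 b0.
rewrite -integral_atan_cst ?expR_ge0// -ge0_integralD//; last 4 first.
- by move=> s _; rewrite lee_fin mulr_ge0// addr_ge0 ?expR_ge0.
- by apply: (@measurable_atan_weight (fun=> expR (a + b))) => t; exact: cvg_cst.
- by move=> s _; rewrite lee_fin mulr_ge0// addr_ge0 ?expR_ge0.
- exact: (measurable_atan_weight _ (continuous_angular_exp a b c1 c2)).
have w0 m : 0 <= epsj R m * bessel m b.
  by rewrite mulr_ge0 ?bessel_ge0// ltW// epsj_gt0.
transitivity (\int[mu]_s \sum_(m <oo) ((epsj R m * bessel m b)%:E *
   ((1 + s ^+ 2)^-1 * (k a c1 c2 m (atan s) + k a c1 c2 m (atan s + pi)))%:E))%E.
  apply: eq_integral => s _; rewrite -EFinD -mulrDr addrACA.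
  rewrite EFinM EFinD -!angular_exp_sum// -nneseriesD; last 2 first.
  - by move=> m _ _; rewrite lee_fin mulr_ge0//; exact: k_ge0.
  - by move=> m _ _; rewrite lee_fin mulr_ge0//; exact: k_ge0.
  rewrite -nneseriesZl; last first.
    by move=> m _; rewrite adde_ge0// lee_fin mulr_ge0//; exact: k_ge0.
  by apply: eq_eseriesr => m _; rewrite -EFinD -!EFinM; congr EFin; rewrite /k; ring.
have W0 m s : (0 <= ((1 + s ^+ 2)^-1 * (k a c1 c2 m (atan s) + k a c1 c2 m (atan s + pi)))%:E)%E.
  by rewrite lee_fin mulr_ge0// addr_ge0// k_ge0.
rewrite integral_nneseries//; last 2 first.
- by move=> m; apply: measurable_funeM; exact: (measurable_atan_weight _ (continuous_k a c1 c2 m)).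
- by move=> m s _; rewrite mule_ge0 ?W0// lee_fin w0.
apply: eq_eseriesr => m _.
rewrite ge0_integralZl_EFin//; last exact: (measurable_atan_weight _ (continuous_k a c1 c2 m)).
rewrite (bessel_angle m a c1 c2 (k a c1 c2 m))// -EFinM; congr EFin; ring.
Qed.

(** The average of [exp(a cos(t + c1) + b cos(2 t + c2))] over a full turn is
    [sum_m epsj m * I_m b * I_(2 m) a * cos (m (2 c1 - c2))]: subtract from
    [angular_integral_shifted] the series [cvg_bessel_sum] of its constant part,
    which is finite. *)
Lemma angular_integral_cvg (a b c1 c2 : R) : 0 <= a -> 0 <= b ->
  series (fun m => 2 * pi * (epsj R m * bessel m b * bessel (2 * m) a *
    cos (m%:R * (2 * c1 - c2)))) @ \oo --> fine (angular_integral a b c1 c2).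
Proof.
move=> a0 b0; have E := angular_integral_shifted a b c1 c2 a0 b0.
have fin := angular_integral_fin a b c1 c2 a0 b0.
set J := angular_integral _ _ _ _ in E fin *.
rewrite -(fineK fin) -EFinD in E.
have w0 m : 0 <= 2 * pi * (epsj R m * bessel m b).
  by rewrite !mulr_ge0 ?pi_ge0 ?bessel_ge0// ltW// epsj_gt0.
have u0 m : 0 <= 2 * pi * (epsj R m * bessel m b) *
      (expR a + bessel (2 * m) a * cos (m%:R * (2 * c1 - c2))).
  by rewrite mulr_ge0// bessel_cos_ge0.
have Ely : (\sum_(m <oo) (2 * pi * (epsj R m * bessel m b) *
      (expR a + bessel (2 * m) a * cos (m%:R * (2 * c1 - c2))))%:E < +oo)%E.
  by rewrite -E ltry.
have [cu] := nneseries_lty_cvg _ u0 Ely.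
rewrite -E => -[JE].
set S := series _ in cu JE.
have -> : fine J = 2 * pi * expR (a + b) + fine J - expR b * (2 * pi * expR a).
  by rewrite expRD; ring.
rewrite (_ : series _ = S \- (series (fun m => epsj R m * bessel m b) \* cst (2 * pi * expR a))).
  apply: cvgB; first by rewrite JE.
  by apply: cvgM; [exact: cvg_bessel_sum|exact: cvg_cst].
apply/funext => n; rewrite /S /series/= mulr_suml -sumrB.
by apply: eq_bigr => m _; ring.
Qed.

End AngularSeries.

(** * Truncated Gamma integrals and convergence of the double series *)

Section Radial.
Context {R : realType}.
Local Notation mu := (@lebesgue_measure R).
Variables (beta : R).
Hypothesis beta0 : 0 < beta.

(** The polynomial for which [- exp(- beta r^2) * gamma_poly l r] is a primitive of
    [2 beta r^(2 l + 1) exp(- beta r^2)]; at [r = u], the inner sum of the terms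
    [T2] is a multiple of it. *)
Definition gamma_poly (l : nat) (r : R) : R :=
  \sum_(1 <= k < (l + 1).+1)
     ((l ^_ (k - 1))%:R / beta ^+ (k - 1)) * r ^+ (2 * l + 2 - 2 * k).

Lemma gamma_poly0 r : gamma_poly 0 r = 1.
Proof. by rewrite /gamma_poly big_nat1 subnn ffactn0 expr0 divr1 mulr1. Qed.

(** The recursion that repeated integration by parts amounts to. *)
Lemma gamma_polyS l r :
  gamma_poly l.+1 r = r ^+ (2 * l.+1) + l.+1%:R / beta * gamma_poly l r.
Proof.
rewrite /gamma_poly addn1 big_nat_recl//; congr (_ + _).
  by rewrite subnn ffactn0 expr0 divr1 mul1r addnK.
rewrite mulr_sumr addn1 big_add1/= [RHS]big_add1/=.
apply: eq_bigr => k _.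
rewrite !subn1/= ffactnS natrM exprS.
have -> : (2 * l.+1 + 2 - 2 * k.+2 = 2 * l + 2 - 2 * k.+1)%N.
  by rewrite !mulnS; lia.
rewrite [l.+1.-1]/=; field; rewrite ?expf_neq0 ?gt_eqF//.
Qed.

Definition gamma_prim l (r : R) := - (expR (- beta * r ^+ 2) * gamma_poly l r).

Lemma is_derive_gamma_prim l (r : R) :
  is_derive r 1 (gamma_prim l) (2 * beta * r ^+ (2 * l).+1 * expR (- beta * r ^+ 2)).
Proof.
elim: l => [|l IH].
  rewrite (_ : gamma_prim 0 = fun r => - expR (- beta * r ^+ 2)); last first.
    by apply/funext => x; rewrite /gamma_prim gamma_poly0 mulr1.
  apply: is_derive_eq.
  by rewrite muln0 /GRing.scale/=; ring.
rewrite (_ : gamma_prim l.+1 = fun r =>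
    l.+1%:R / beta * gamma_prim l r - expR (- beta * r ^+ 2) * r ^+ (2 * l.+1)); last first.
  by apply/funext => x; rewrite /gamma_prim gamma_polyS; ring.
move: (gamma_prim l) IH => G IH.
have -> : (2 * l.+1 = (2 * l).+2)%N by rewrite mulnS.
have : l.+1%:R = (2 * l).+2%:R / 2 :> R 
  by rewrite (_ : (2 * l).+2 = 2 * l.+1)%N; [rewrite natrM; field|rewrite mulnS].
move: l.+1%:R (2 * l)%N IH => c n IH cE.
have d1 : is_derive r 1 (fun x => expR (- beta * x ^+ 2) * x ^+ n.+2)
    (expR (- beta * r ^+ 2) * (n.+2%:R * r ^+ n.+1)
     - 2 * beta * r * expR (- beta * r ^+ 2) * r ^+ n.+2).
  have d0 : is_derive r 1 (fun x : R => x ^+ n.+2) (n.+2%:R * r ^+ n.+1).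
    have := @is_deriveX R R id n.+2 r 1 1 (is_derive_id r 1).
    rewrite /GRing.scale/= mulr1; congr is_derive.
    by apply/funext => x; rewrite exprfctE.
  apply: is_derive_eq; rewrite /GRing.scale/= !exprS; ring.
have d2 := is_deriveB (is_deriveZ (c / beta) IH) d1.
apply: (is_derive_eq d2).
rewrite /GRing.scale/= !exprS cE.
by field; rewrite gt_eqF.
Qed.

Lemma gamma_prim_at0 l : gamma_prim l 0 = - (l`!%:R / beta ^+ l).
Proof.
rewrite /gamma_prim expr0n mulr0 expR0 mul1r; congr (- _).
elim: l => [|l IH]; first by rewrite gamma_poly0 expr0 divr1.
rewrite gamma_polyS IH expr0n/= add0r factS natrM exprS.
by field; rewrite expf_neq0 ?gt_eqF.
Qed.

(** The lower incomplete Gamma function at [(l + 1, beta u^2)], divided by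
    [beta^l]. *)
Definition inc_gamma l (u : R) : R :=
  l`!%:R / beta ^+ l - expR (- beta * u ^+ 2) * gamma_poly l u.

Lemma integral_radial l (u : R) : 0 < u ->
  (\int[mu]_(r in `]0%R, u]) (2 * beta * r ^+ (2 * l).+1 * expR (- beta * r ^+ 2))%:E
   = (inc_gamma l u)%:E)%E.
Proof.
move=> u0.
pose f (r : R) := 2 * beta * r ^+ (2 * l).+1 * expR (- beta * r ^+ 2).
have ce : continuous (fun r : R => expR (- beta * r ^+ 2)).
  by move=> t; apply/differentiable_continuous/derivable1_diffP; exact: ex_derive.
have cf : continuous f.
  move=> t; apply: cvgM; last exact: ce.
  by apply: cvgM; [exact: cvg_cst|exact: exprn_continuous].
have dF := is_derive_gamma_prim l.
have cF : continuous (gamma_prim l).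
  by move=> t; apply/differentiable_continuous/derivable1_diffP; exact: ex_derive.
rewrite integral_itv_obnd_cbnd; last first.
  by apply/measurable_EFinP/measurable_funTS; exact: continuous_measurable_fun.
rewrite (@continuous_FTC2 _ f (gamma_prim l))//.
- by rewrite -EFinB gamma_prim_at0 /inc_gamma opprK addrC.
- exact: continuous_subspaceT.
- split.
  + by move=> x _; exact: ex_derive.
  + by apply: cvg_at_right_filter; exact: cF.
  + by apply: cvg_at_left_filter; exact: cF.
- by move=> x _; rewrite derive1E derive_val.
Qed.

Lemma inc_gamma_ge0 l (u : R) : 0 < u -> 0 <= inc_gamma l u.
Proof.
move=> u0; rewrite -lee_fin -integral_radial//; apply: integral_ge0 => r /=.
rewrite in_itv/= => /andP[r0 _].
by rewrite lee_fin mulr_ge0 ?expR_ge0// mulr_ge0 ?exprn_ge0 ?mulr_ge0// ltW.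
Qed.

End Radial.

Section DoubleSeries.
Context {R : realType}.

(** The passage from iterated sums of extended reals to the iterated limits of
    [dseries]. *)
Lemma nneseries_dseries (a : nat -> nat -> R) : (forall i j, 0 <= a i j) ->
  (\sum_(i <oo) \sum_(j <oo) (a i j)%:E < +oo)%E ->
  dseries_cvg a /\ (\sum_(i <oo) \sum_(j <oo) (a i j)%:E = (dseries a)%:E)%E.
Proof.
move=> a0 alty.
have in0 i : (0 <= \sum_(j <oo) (a i j)%:E)%E.
  by apply: nneseries_ge0 => j _ _; rewrite lee_fin.
have inlty i : (\sum_(j <oo) (a i j)%:E < +oo)%E.
  rewrite ltey; apply/eqP => ai.
  by move: alty; rewrite (nneseries_pinfty (k := i)) ?ai.
have inE i := nneseries_lty_cvg _ (a0 i) (inlty i).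
have l0 i : 0 <= limn (series (a i)) by rewrite -lee_fin -(inE i).2.
have E : (\sum_(i <oo) \sum_(j <oo) (a i j)%:E =
          \sum_(i <oo) (limn (series (a i)))%:E)%E.
  by apply: eq_eseriesr => i _; exact: (inE i).2.
rewrite E in alty *.
have [c1 c2] := nneseries_lty_cvg _ l0 alty.
by split=> //; split=> // i; exact: (inE i).1.
Qed.

(** The partial sums of the negative binomial series.  Multiplication by [1 - x]
    lowers [n] by one, up to a nonpositive boundary term, by Pascal's rule. *)
Lemma neg_binomial_le (x : R) n N : 0 <= x < 1 ->
  \sum_(0 <= i < N) 'C(n + i, i)%:R * x ^+ i <= (1 - x)^-1 ^+ n.+1.
Proof.
move=> /andP[x0 x1]; have x1' : 0 < 1 - x by rewrite subr_gt0.
elim: n => [|n IH].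
  have E : (1 - x) * \sum_(0 <= i < N) 'C(0 + i, i)%:R * x ^+ i = 1 - x ^+ N.
    elim: N => [|N IH]; first by rewrite big_nil mulr0 expr0 subrr.
    by rewrite big_nat_recr//= mulrDr IH add0n binn exprS; ring.
  rewrite expr1 -[leRHS]mulr1 ler_pdivlMl// E gerBl exprn_ge0//.
rewrite [leRHS]exprS ler_pdivlMl//.
apply: le_trans IH.
case: N => [|N]; first by rewrite !big_nil mulr0.
have -> : (1 - x) * \sum_(0 <= i < N.+1) 'C(n.+1 + i, i)%:R * x ^+ i =
    \sum_(0 <= i < N.+1) 'C(n + i, i)%:R * x ^+ i - 'C(n.+1 + N, N)%:R * x ^+ N.+1.
  elim: N => [|N IH]; first by rewrite !big_nat1 !bin0; ring.
  rewrite big_nat_recr//= mulrDr IH [in RHS]big_nat_recr//=.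
  have -> : 'C(n.+1 + N.+1, N.+1) = ('C(n + N.+1, N.+1) + 'C(n.+1 + N, N))%N.
    by rewrite addSn binS addSnnS.
  by rewrite natrD [x ^+ N.+2]exprS; ring.
by rewrite gerBl mulr_ge0// exprn_ge0.
Qed.

Lemma sum_even_le (f : nat -> R) N : (forall i, 0 <= f i) ->
  \sum_(0 <= k < N) f (2 * k)%N <= \sum_(0 <= i < 2 * N) f i.
Proof.
move=> f0; elim: N => [|N IH]; first by rewrite !big_nil.
rewrite mulnS big_nat_recr//= !addSn add0n !big_nat_recr//=.
by rewrite -[leRHS]addrA lerD// lerDl.
Qed.

Section T1bound.
Variables (beta psi eta : R).
Hypotheses (beta0 : 0 < beta) (psi0 : 0 <= psi) (eta0 : 0 <= eta) (etab : eta < beta).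
Let x := eta / beta.

Lemma Ccoef_ge0 k1 k2 j : 0 <= Ccoef psi eta k1 k2 j.
Proof. by rewrite /Ccoef !(mulr_ge0, invr_ge0, exprn_ge0). Qed.

(** With [n = k1 + 2 j], the factorial of [ell = n + 2 k2] is the product of a
    binomial coefficient, [n!] and [(2 k2)!], and the last one is at most
    [4^k2 * k2! * (k2 + j)!].  What remains is an exponential series in [k1] and
    the even terms of a negative binomial series in [k2]. *)
Lemma T1_le k1 k2 j :
  T1 beta psi eta k1 k2 j <=
  (beta ^+ (2 * j))^-1 * exp_coeff (psi ^+ 2 / (4 * beta)) k1 *
  ('C(k1 + 2 * j + 2 * k2, 2 * k2)%:R * x ^+ (2 * k2)).
Proof.
set n := (k1 + 2 * j)%N.
have fk (i : nat) : (i`!%:R : R) != 0 by rewrite pnatr_eq0 -lt0n fact_gt0.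
have fp (i : nat) : 0 < (i`!%:R : R) by rewrite ltr0n fact_gt0.
have ellE : ell k1 k2 j = (n + 2 * k2)%N by rewrite /ell /n; lia.
have lE : ((ell k1 k2 j)`!%:R : R) = 'C(n + 2 * k2, 2 * k2)%:R * ((2 * k2)`!%:R * n`!%:R).
  by rewrite ellE -(bin_fact (leq_addl n (2 * k2)%N)) addnK !natrM.
(* The central binomial coefficient of [2 k2] is one of the terms of the
   expansion of [(1 + 1)^(2 k2)]. *)
have dble : ((2 * k2)`!%:R : R) <= 4 ^+ k2 * (k2`!%:R * (k2 + j)`!%:R).
  rewrite -natrX -!natrM ler_nat.
  have -> : (2 * k2)`! = ('C(2 * k2, k2) * (k2`! * k2`!))%N.
    by rewrite -(bin_fact (m := k2) (n := 2 * k2)); [congr (_ * (_ * _`!))%N; lia|lia].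
  apply: leq_mul; last by rewrite leq_mul2l leq_fact ?orbT// leq_addr.
  rewrite (_ : 4 ^ k2 = 2 ^ (2 * k2))%N; last by rewrite expnM.
  have k2l : (k2 < (2 * k2).+1)%N by lia.
  rewrite -[2%N]/(1 + 1)%N expnDn (bigD1 (Ordinal k2l))//= !exp1n !muln1.
  exact: leq_addr.
rewrite /T1 /Ccoef lE -/n ellE.
rewrite [leLHS](_ : _ = (beta ^+ (2 * j))^-1 * exp_coeff (psi ^+ 2 / (4 * beta)) k1 *
  ('C(n + 2 * k2, 2 * k2)%:R * x ^+ (2 * k2)) *
  ((2 * k2)`!%:R / (4 ^+ k2 * (k2`!%:R * (k2 + j)`!%:R)))); last first.
  have -> : beta ^+ (n + 2 * k2) = beta ^+ k1 * beta ^+ (2 * j) * beta ^+ (2 * k2).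
    by rewrite -!exprD.
  have -> : x ^+ (2 * k2) = eta ^+ (2 * k2) / beta ^+ (2 * k2) by rewrite expr_div_n.
  rewrite /exp_coeff/= expr_div_n [(4 * _) ^+ _]exprMn -exprM exprD.
  by field; rewrite !fk !expf_neq0 ?gt_eqF.
rewrite ler_piMr//.
  rewrite mulr_ge0 ?mulr_ge0 ?invr_ge0 ?exprn_ge0 ?exp_coeff_ge0 ?divr_ge0 ?exprn_ge0//.
  - exact: ltW.
  - by rewrite mulr_ge0// ltW.
  - exact: ltW.
rewrite ler_pdivrMr ?mul1r// mulr_gt0 ?exprn_gt0// mulr_gt0//.
Qed.

Lemma T1_ge0 k1 k2 j : 0 <= T1 beta psi eta k1 k2 j.
Proof.
by rewrite /T1 mulr_ge0 ?Ccoef_ge0// divr_ge0// exprn_ge0// ltW.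
Qed.

(** The negative binomial series in [k2] has the ratio [eta / beta < 1]; its sum
    is geometric in [k1], hence absorbed by the exponential series. *)
Lemma T1_summable j :
  (\sum_(k1 <oo) \sum_(k2 <oo) (T1 beta psi eta k1 k2 j)%:E < +oo)%E.
Proof.
have x0 : 0 <= x by rewrite divr_ge0// ltW.
have x1 : x < 1 by rewrite ltr_pdivrMr// mul1r.
have y0 : 0 <= psi ^+ 2 / (4 * beta) by rewrite divr_ge0 ?exprn_ge0// mulr_ge0// ltW.
have b0 : 0 <= (beta ^+ (2 * j))^-1 by rewrite invr_ge0 exprn_ge0// ltW.
pose w := psi ^+ 2 / (4 * beta) / (1 - x).
have inner k1 : (\sum_(k2 <oo) (T1 beta psi eta k1 k2 j)%:E <=
    ((beta ^+ (2 * j))^-1 * (1 - x)^-1 ^+ (2 * j).+1 * exp_coeff w k1)%:E)%E.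
  apply: lime_le; first by apply: is_cvg_nneseries => k2 _ _; rewrite lee_fin T1_ge0.
  apply: nearW => N; rewrite sumEFin lee_fin.
  apply: (@le_trans _ _ ((beta ^+ (2 * j))^-1 * exp_coeff (psi ^+ 2 / (4 * beta)) k1 *
     \sum_(0 <= i < 2 * N) 'C(k1 + 2 * j + i, i)%:R * x ^+ i)).
    have A0 : 0 <= (beta ^+ (2 * j))^-1 * exp_coeff (psi ^+ 2 / (4 * beta)) k1.
      by rewrite mulr_ge0// exp_coeff_ge0.
    apply: le_trans (ler_wpM2l A0 (sum_even_le _ N _)); last first.
      by move=> i; rewrite mulr_ge0// exprn_ge0.
    by rewrite mulr_sumr; apply: ler_sum => k2 _; exact: T1_le.
  rewrite -[leRHS]mulrA -[leLHS]mulrA; apply: ler_wpM2l => //.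
  have -> : (1 - x)^-1 ^+ (2 * j).+1 * exp_coeff w k1 =
     exp_coeff (psi ^+ 2 / (4 * beta)) k1 * (1 - x)^-1 ^+ (k1 + 2 * j).+1.
    by rewrite /exp_coeff/= /w [in LHS]exprMn -addnS exprD; ring.
  apply: ler_wpM2l; first exact: exp_coeff_ge0.
  by apply: neg_binomial_le; rewrite x0 x1.
apply: (@le_lt_trans _ _ (\sum_(k1 <oo) ((beta ^+ (2 * j))^-1 * (1 - x)^-1 ^+ (2 * j).+1 * exp_coeff w k1)%:E)%E).
  apply: lee_nneseries => // k1 _ _; apply: nneseries_ge0 => k2 _ _.
  by rewrite lee_fin T1_ge0.
rewrite (nneseries_EFin _ ((beta ^+ (2 * j))^-1 * (1 - x)^-1 ^+ (2 * j).+1 * expR w)) ?ltry//.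
rewrite (_ : series _ = (fun n => ((beta ^+ (2 * j))^-1 * (1 - x)^-1 ^+ (2 * j).+1) * series (exp_coeff w) n)).
  by apply: cvgM; [exact: cvg_cst|exact: is_cvg_series_exp_coeff].
by apply/funext => n; rewrite /series/= mulr_sumr.
Qed.

End T1bound.
End DoubleSeries.

(** * Radial integral of a product of Bessel functions *)

Section RadialSeries.
Context {R : realType}.
Local Notation mu := (@lebesgue_measure R).
Local Notation e := (@exp_coeff R).
Variables (beta psi eta : R).
Hypotheses (beta0 : 0 < beta) (psi0 : 0 <= psi) (eta0 : 0 <= eta) (etab : eta < beta).
Variable u : R.
Hypothesis u0 : 0 < u.

Local Notation S1 j := (fun k1 k2 : nat => T1 beta psi eta k1 k2 j).
Local Notation S2 j := (fun k1 k2 : nat =>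
  \sum_(1 <= k < (ell k1 k2 j + 1).+1) T2 beta u psi eta k1 k2 j k).
Local Notation inc_term j := (fun k1 k2 : nat =>
  Ccoef psi eta k1 k2 j * inc_gamma beta (ell k1 k2 j) u).

Lemma sum_T2E k1 k2 j :
  \sum_(1 <= k < (ell k1 k2 j + 1).+1) T2 beta u psi eta k1 k2 j k =
  Ccoef psi eta k1 k2 j * gamma_poly beta (ell k1 k2 j) u.
Proof.
by rewrite /gamma_poly mulr_sumr; apply: eq_bigr => k _; rewrite /T2 -mulrA.
Qed.

Lemma gamma_poly_ge0 l : 0 <= gamma_poly beta l u.
Proof.
apply: sumr_ge0 => k _.
by rewrite mulr_ge0 ?divr_ge0 ?exprn_ge0// ltW.
Qed.

Lemma sum_T2_ge0 j k1 k2 : 0 <= S2 j k1 k2.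
Proof. by rewrite /= sum_T2E mulr_ge0 ?Ccoef_ge0 ?gamma_poly_ge0. Qed.

Lemma inc_term_ge0 j k1 k2 : 0 <= inc_term j k1 k2.
Proof. by rewrite mulr_ge0 ?Ccoef_ge0 ?inc_gamma_ge0. Qed.

(** The terms of the series are linked by the closed form of the incomplete Gamma
    function; all three families are nonnegative. *)
Lemma T1_split j k1 k2 :
  S1 j k1 k2 = inc_term j k1 k2 + expR (- beta * u ^+ 2) * S2 j k1 k2.
Proof. by rewrite /= sum_T2E /inc_gamma /T1; ring. Qed.

Lemma nneseries2_axpy (a b : nat -> nat -> R) c : (forall i j, 0 <= a i j) ->
  (forall i j, 0 <= b i j) -> 0 <= c ->
  (\sum_(i <oo) \sum_(j <oo) (a i j + c * b i j)%:E =
   \sum_(i <oo) \sum_(j <oo) (a i j)%:E + c%:E * \sum_(i <oo) \sum_(j <oo) (b i j)%:E)%E.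
Proof.
move=> a0 b0 c0.
have ia i : (0 <= \sum_(j <oo) (a i j)%:E)%E.
  by apply: nneseries_ge0 => j _ _; rewrite lee_fin.
have ib i : (0 <= \sum_(j <oo) (b i j)%:E)%E.
  by apply: nneseries_ge0 => j _ _; rewrite lee_fin.
rewrite -nneseriesZl// -nneseriesD//; last first.
  by move=> i _ _; rewrite mule_ge0.
apply: eq_eseriesr => i _; rewrite -nneseriesZl//; last first.
  by move=> j _; rewrite lee_fin.
by rewrite -nneseriesD// => j _ _; rewrite lee_fin// mulr_ge0.
Qed.

(** Since [T1] is the sum of the two other nonnegative families, its summability
    implies theirs. *)
Lemma dseries_inc_gamma j :
  [/\ dseries_cvg (S1 j), dseries_cvg (S2 j) &
   (\sum_(k1 <oo) \sum_(k2 <oo) (inc_term j k1 k2)%:E =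
    (dseries (S1 j) - expR (- beta * u ^+ 2) * dseries (S2 j))%:E)%E].
Proof.
have T0 := fun k1 k2 => T1_ge0 beta psi eta beta0 psi0 eta0 k1 k2 j.
have Tly := T1_summable beta psi eta beta0 psi0 eta0 etab j.
have [c1 E1] := nneseries_dseries _ T0 Tly.
have E : (\sum_(k1 <oo) \sum_(k2 <oo) (S1 j k1 k2)%:E =
    \sum_(k1 <oo) \sum_(k2 <oo) (inc_term j k1 k2)%:E + (expR (- beta * u ^+ 2))%:E *
    \sum_(k1 <oo) \sum_(k2 <oo) (S2 j k1 k2)%:E)%E.
  rewrite -(nneseries2_axpy _ _ _ (inc_term_ge0 j) (sum_T2_ge0 j) (expR_ge0 _)).
  by apply: eq_eseriesr => k1 _; apply: eq_eseriesr => k2 _; rewrite -T1_split.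
rewrite E1 in E.
have i0 : (0 <= \sum_(k1 <oo) \sum_(k2 <oo) (inc_term j k1 k2)%:E)%E.
  by apply: nneseries_ge0 => k1 _ _; apply: nneseries_ge0 => k2 _ _; rewrite lee_fin inc_term_ge0.
have i2 : (0 <= \sum_(k1 <oo) \sum_(k2 <oo) (S2 j k1 k2)%:E)%E.
  by apply: nneseries_ge0 => k1 _ _; apply: nneseries_ge0 => k2 _ _; rewrite lee_fin sum_T2_ge0.
have ily : (\sum_(k1 <oo) \sum_(k2 <oo) (inc_term j k1 k2)%:E < +oo)%E.
  by apply: (@le_lt_trans _ _ (dseries (S1 j))%:E); rewrite ?ltry// E leeDl// mule_ge0// lee_fin expR_ge0.
have i2ly : (\sum_(k1 <oo) \sum_(k2 <oo) (S2 j k1 k2)%:E < +oo)%E.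
  rewrite ltey; apply/eqP => S2y.
  move: E; rewrite S2y gt0_muley ?lte_fin ?expR_gt0// addey//.
  by rewrite gt_eqF// (lt_le_trans _ i0)// ltNy0.
have [ci Ei] := nneseries_dseries _ (inc_term_ge0 j) ily.
have [c2 E2] := nneseries_dseries _ (sum_T2_ge0 j) i2ly.
split => //; move: E; rewrite Ei E2 -EFinM -EFinD => -[->].
by congr EFin; ring.
Qed.

Lemma bessel_product_series (a b w : R) n m : 0 <= a -> 0 <= b -> 0 <= w ->
  ((w * (bessel n a * bessel m b))%:E = \sum_(k1 <oo) \sum_(k2 <oo)
     (w * ((e (a / 2) k1 * e (a / 2) (k1 + n)%N) *
           (e (b / 2) k2 * e (b / 2) (k2 + m)%N)))%:E)%E.
Proof.
move=> a0 b0 w0.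
have -> : w * (bessel n a * bessel m b) = w * bessel m b * bessel n a by ring.
rewrite EFinM besselE// -nneseriesZl; last first.
  by move=> k _; rewrite lee_fin bessel_term_ge0.
apply: eq_eseriesr => k1 _.
set p := e (a / 2) k1 * _.
have p0 : 0 <= p by exact: bessel_term_ge0.
rewrite -EFinM (_ : _ * p = w * p * bessel m b); last by ring.
rewrite EFinM besselE// -nneseriesZl; last first.
  by move=> k _; rewrite lee_fin bessel_term_ge0.
by apply: eq_eseriesr => k2 _; rewrite -EFinM mulrA.
Qed.

Lemma bessel_product_term (r : R) j k1 k2 :
  (e (psi * r / 2) k1 * e (psi * r / 2) (k1 + 2 * j)%N) *
  (e (eta * r ^+ 2 / 2) k2 * e (eta * r ^+ 2 / 2) (k2 + j)%N) =
  (eta * psi ^+ 2 / 8) ^+ j * (Ccoef psi eta k1 k2 j * r ^+ (2 * ell k1 k2 j)).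
Proof.
have fk (i : nat) : (i`!%:R : R) != 0 by rewrite pnatr_eq0 -lt0n fact_gt0.
rewrite /exp_coeff/= /Ccoef.
have E1 : (psi * r / 2) ^+ k1 * (psi * r / 2) ^+ (k1 + 2 * j) =
  psi ^+ (2 * k1) * (psi ^+ 2) ^+ j / (4 ^+ k1 * 4 ^+ j) * r ^+ (2 * k1 + 2 * j).
  rewrite -exprD (_ : k1 + (k1 + 2 * j) = 2 * (k1 + j))%N; last by lia.
  rewrite expr_div_n exprMn.
  have -> : 2 ^+ (2 * (k1 + j)) = 4 ^+ k1 * 4 ^+ j :> R.
    by rewrite exprM -exprD expr2 -natrM.
  have -> : psi ^+ (2 * (k1 + j)) = psi ^+ (2 * k1) * (psi ^+ 2) ^+ j.
    by rewrite -exprM -exprD mulnDr.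
  by rewrite mulnDr; field; rewrite !expf_neq0.
have E2 : (eta * r ^+ 2 / 2) ^+ k2 * (eta * r ^+ 2 / 2) ^+ (k2 + j) =
  eta ^+ (2 * k2) * eta ^+ j / (4 ^+ k2 * 2 ^+ j) * r ^+ (4 * k2 + 2 * j).
  rewrite -exprD (_ : k2 + (k2 + j) = 2 * k2 + j)%N; last by lia.
  rewrite expr_div_n exprMn -exprM.
  have -> : 2 ^+ (2 * k2 + j) = 4 ^+ k2 * 2 ^+ j :> R.
    by rewrite exprD exprM expr2 -natrM.
  rewrite exprD (_ : 2 * (2 * k2 + j) = 4 * k2 + 2 * j)%N; last by lia.
  by field; rewrite !expf_neq0.
have E3 : (eta * psi ^+ 2 / 8) ^+ j = eta ^+ j * (psi ^+ 2) ^+ j / (4 ^+ j * 2 ^+ j).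
  rewrite (_ : 8 = 4 * 2 :> R); last by rewrite -natrM.
  by rewrite expr_div_n !exprMn.
have E4 : r ^+ (2 * ell k1 k2 j) = r ^+ (2 * k1 + 2 * j) * r ^+ (4 * k2 + 2 * j).
  by rewrite -exprD; congr (_ ^+ _); rewrite /ell; lia.
rewrite E3 E4 [4 ^+ (k1 + k2)]exprD.
transitivity (((psi * r / 2) ^+ k1 * (psi * r / 2) ^+ (k1 + 2 * j)) *
  ((eta * r ^+ 2 / 2) ^+ k2 * (eta * r ^+ 2 / 2) ^+ (k2 + j)) /
  (k1`!%:R * (k1 + 2 * j)`!%:R * k2`!%:R * (k2 + j)`!%:R)).
  by field; rewrite !fk.
by rewrite E1 E2; field; rewrite !fk !expf_neq0.
Qed.

(** Both Bessel series are multiplied out and integrated termwise, by monotone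
    convergence; the monomial of degree [2 ell] gives the incomplete Gamma value
    of rank [ell]. *)
Lemma integral_bessel_product j :
  (\int[mu]_(r in `]0%R, u]) (2 * beta * r * expR (- beta * r ^+ 2) *
     (bessel (2 * j) (psi * r) * bessel j (eta * r ^+ 2)))%:E =
   ((eta * psi ^+ 2 / 8) ^+ j *
    (dseries (S1 j) - expR (- beta * u ^+ 2) * dseries (S2 j)))%:E)%E.
Proof.
have [_ _ E] := dseries_inc_gamma j; rewrite EFinM -E => {E}.
pose x := (eta * psi ^+ 2 / 8) ^+ j.
have x0 : 0 <= x by rewrite exprn_ge0// divr_ge0// mulr_ge0// exprn_ge0.
pose g l (r : R) := 2 * beta * r ^+ (2 * l).+1 * expR (- beta * r ^+ 2).
have cg l : continuous (g l).
  have ce : continuous (fun r : R => expR (- beta * r ^+ 2)).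
    by move=> t; apply/differentiable_continuous/derivable1_diffP; exact: ex_derive.
  move=> t; apply: cvgM; last exact: ce.
  by apply: cvgM; [exact: cvg_cst|exact: exprn_continuous].
have g0 l r : 0 <= r -> 0 <= g l r.
  by move=> r0; rewrite mulr_ge0 ?expR_ge0// mulr_ge0 ?exprn_ge0// mulr_ge0// ltW.
pose f k1 k2 (r : R) :=
  ((x * Ccoef psi eta k1 k2 j)%:E * (g (ell k1 k2 j) r)%:E)%E.
have D0 (r : R) : `]0%R, u]%classic r -> 0 <= r by rewrite /= in_itv/= => /andP[/ltW].
have f0 k1 k2 r : 0 <= r -> (0 <= f k1 k2 r)%E.
  by move=> r0; rewrite mule_ge0// lee_fin ?g0// mulr_ge0// Ccoef_ge0.
have mf k1 k2 : measurable_fun `]0%R, u] (f k1 k2).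
  apply: measurable_funeM; apply/measurable_EFinP/measurable_funTS.
  exact: continuous_measurable_fun.
transitivity (\int[mu]_(r in `]0%R, u]) \sum_(k1 <oo) \sum_(k2 <oo) f k1 k2 r)%E.
  apply: eq_integral => r; rewrite inE => /D0 r0.
  have a0 : 0 <= psi * r by rewrite mulr_ge0.
  have b0 : 0 <= eta * r ^+ 2 by rewrite mulr_ge0// exprn_ge0.
  have w0 : 0 <= 2 * beta * r * expR (- beta * r ^+ 2).
    by rewrite mulr_ge0 ?expR_ge0// mulr_ge0// mulr_ge0// ltW.
  rewrite bessel_product_series//.
  apply: eq_eseriesr => k1 _; apply: eq_eseriesr => k2 _.
  rewrite bessel_product_term /f -EFinM; congr EFin.
  by rewrite /g (exprS r (2 * ell k1 k2 j)) /x; ring.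
rewrite integral_nneseries//; last 2 first.
- by move=> k1; apply: ge0_emeasurable_sum => [k2 r /D0 r0 _|k2 _]; [exact: f0|exact: mf].
- by move=> k1 r /D0 r0; apply: nneseries_ge0 => k2 _ _; exact: f0.
rewrite -nneseriesZl; last first.
  by move=> k1 _; apply: nneseries_ge0 => k2 _ _; rewrite lee_fin inc_term_ge0.
apply: eq_eseriesr => k1 _.
rewrite integral_nneseries//; last 2 first.
- by move=> k2; exact: mf.
- by move=> k2 r /D0 r0; exact: f0.
rewrite -nneseriesZl; last by move=> k2 _; rewrite lee_fin inc_term_ge0.
apply: eq_eseriesr => k2 _.
rewrite ge0_integralZl_EFin//; last 3 first.
- by move=> r /D0 r0; rewrite lee_fin g0.
- by apply/measurable_EFinP/measurable_funTS; exact: continuous_measurable_fun.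
- by rewrite mulr_ge0// Ccoef_ge0.
by rewrite integral_radial// -!EFinM -[in LHS]mulrA.
Qed.
End RadialSeries.

(** * Integration over the radius of the disc *)

Section Assembly.
Context {R : realType}.
Local Notation mu := (@lebesgue_measure R).
Local Notation e := (@exp_coeff R).

Lemma measurable_bessel_comp d (T : measurableType d) (D : set T) (g : T -> R) n :
  measurable D -> measurable_fun D g -> (forall t, D t -> 0 <= g t) ->
  measurable_fun D (fun t => bessel n (g t)).
Proof.
move=> mD mg g0.
apply: (measurable_fun_cvg (h := fun N t => series (fun k => e (g t / 2) k * e (g t / 2) (k + n)%N) N)).
  move=> N; apply: measurable_sum => k.
  have mX m : measurable_fun D (fun t => e (g t / 2) m).
    apply: measurable_funM; last exact: measurable_cst.
    by apply: measurable_funX; apply: measurable_funM => //; exact: measurable_cst.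
  by apply: measurable_funM; exact: mX.
by move=> t Dt; apply: cvg_series_bessel; exact: g0.
Qed.

Variables (beta psi eta : R).
Hypotheses (beta0 : 0 < beta) (psi0 : 0 <= psi) (eta0 : 0 <= eta) (etab : eta < beta).
Variables (u alpha : R).
Hypotheses (u0 : 0 < u) (alpha0 : 0 < alpha).

Let DS (j : nat) : R :=
  dseries (fun k1 k2 => T1 beta psi eta k1 k2 j) - expR (- beta * u ^+ 2) *
  dseries (fun k1 k2 => \sum_(1 <= k < (ell k1 k2 j + 1).+1) T2 beta u psi eta k1 k2 j k).

Let x := eta * psi ^+ 2 / 8.

Let D := `]0%R, u]%classic.
Let mD : measurable D. Proof. exact: measurable_itv. Qed.
Let D0 (r : R) : D r -> 0 <= r. Proof. by rewrite /D/= in_itv/= => /andP[/ltW]. Qed.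
Let a0 (r : R) : D r -> 0 <= psi * r. Proof. by move=> /D0 r0; rewrite mulr_ge0. Qed.
Let b0 (r : R) : D r -> 0 <= eta * r ^+ 2.
Proof. by move=> /D0 r0; rewrite mulr_ge0// exprn_ge0. Qed.
Let w (r : R) := 2 * beta * r * expR (- beta * r ^+ 2).
Let w0 (r : R) : D r -> 0 <= w r.
Proof. by move=> /D0 r0; rewrite mulr_ge0 ?expR_ge0// mulr_ge0// mulr_ge0// ltW. Qed.
Let BB m r := bessel (2 * m) (psi * r) * bessel m (eta * r ^+ 2).
Let BB0 m r : D r -> 0 <= BB m r.
Proof. by move=> Dr; rewrite mulr_ge0 ?bessel_ge0 ?a0 ?b0. Qed.

Let mw : measurable_fun D w.
Proof.
apply: measurable_funTS; apply: continuous_measurable_fun => t.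
by apply/differentiable_continuous/derivable1_diffP; rewrite /w; exact: ex_derive.
Qed.

Let mBB m : measurable_fun D (BB m).
Proof.
apply: measurable_funM; apply: measurable_bessel_comp => //; try exact: a0; try exact: b0.
apply: measurable_funM; first exact: measurable_cst.
by apply: measurable_funTS; exact: exprn_measurable.
Qed.

(** The mass of the disc of radius [u], in polar coordinates. *)
Definition radial_angular c1 c2 : \bar R :=
  (\int[mu]_(r in D) ((alpha / (2 * pi) * r * expR (- beta * r ^+ 2))%:E *
     angular_integral (psi * r) (eta * r ^+ 2) c1 c2))%E.

Let DS_ge0 m : 0 <= x ^+ m * DS m.
Proof.
rewrite -lee_fin -(integral_bessel_product beta psi eta beta0 psi0 eta0 etab u u0 m).
by apply: integral_ge0 => r Dr; rewrite lee_fin mulr_ge0 ?BB0 ?w0.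
Qed.

(** Nonnegative weights [q] suffice: they will be 1 and [1 + cos]. *)
Lemma integral_bessel_series (q : nat -> R) (I : R -> \bar R) : (forall m, 0 <= q m) ->
  (forall r, D r -> I r = \sum_(m <oo) (2 * pi * (epsj R m * bessel m (eta * r ^+ 2) *
     bessel (2 * m) (psi * r) * q m))%:E)%E ->
  (\int[mu]_(r in D) ((alpha / (2 * pi) * r * expR (- beta * r ^+ 2))%:E * I r) =
   \sum_(m <oo) (alpha / (2 * beta) * (epsj R m * (x ^+ m * DS m) * q m))%:E)%E.
Proof.
move=> q0 IE.
have pi0 : (pi : R) != 0 by rewrite gt_eqF// pi_gt0.
pose C m := alpha / (2 * beta) * (epsj R m * q m).
have C0 m : 0 <= C m.
  by rewrite mulr_ge0 ?(mulr_ge0 (ltW (epsj_gt0 m)))// ltW// divr_gt0// mulr_gt0.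
transitivity (\int[mu]_(r in D) \sum_(m <oo) ((C m)%:E * (w r * BB m r)%:E))%E.
  apply: eq_integral => r; rewrite inE => Dr; rewrite IE// -nneseriesZl; last first.
    move=> m _; rewrite lee_fin !mulr_ge0 ?pi_ge0 ?bessel_ge0 ?a0 ?b0//.
    by rewrite ltW// epsj_gt0.
  apply: eq_eseriesr => m _; rewrite -!EFinM; congr EFin.
  rewrite /C /w /BB; move: (pi : R) pi0 => p p0.
  by field; rewrite p0 gt_eqF.
have W0 m r : D r -> (0 <= (w r * BB m r)%:E)%E.
  by move=> Dr; rewrite lee_fin mulr_ge0 ?BB0 ?w0.
have mW m : measurable_fun D (fun r => (w r * BB m r)%:E).
  by apply/measurable_EFinP; exact: measurable_funM.
rewrite integral_nneseries//; last 2 first.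
- by move=> m; apply: measurable_funeM; exact: mW.
- by move=> m r Dr; rewrite mule_ge0 ?W0// lee_fin.
apply: eq_eseriesr => m _.
rewrite ge0_integralZl_EFin//; last 2 first.
- by move=> r Dr; exact: W0.
- exact: mW.
rewrite integral_bessel_product// -EFinM; congr EFin.
by rewrite /C /DS /x; ring.
Qed.

Let I0E r : D r -> (angular_integral (psi * r) (eta * r ^+ 2) 0 0 =
  \sum_(m <oo) (2 * pi * (epsj R m * bessel m (eta * r ^+ 2) *
     bessel (2 * m) (psi * r) * 1))%:E)%E.
Proof.
move=> Dr; have fin := angular_integral_fin _ _ 0 0 (a0 _ Dr) (b0 _ Dr).
rewrite -(fineK fin); apply/esym/nneseries_EFin.
have := angular_integral_cvg _ _ 0 0 (a0 _ Dr) (b0 _ Dr).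
apply: cvg_trans; apply: near_eq_cvg; apply: nearW => n.
by apply: eq_bigr => m _; rewrite !mulr0 subr0 mulr0 cos0.
Qed.

Let IE c1 c2 r : D r -> (angular_integral (psi * r) (eta * r ^+ 2) c1 c2 +
   angular_integral (psi * r) (eta * r ^+ 2) 0 0 =
  \sum_(m <oo) (2 * pi * (epsj R m * bessel m (eta * r ^+ 2) *
     bessel (2 * m) (psi * r) * (1 + cos (m%:R * (2 * c1 - c2)))))%:E)%E.
Proof.
move=> Dr; have fin c c' := angular_integral_fin _ _ c c' (a0 _ Dr) (b0 _ Dr).
rewrite -(fineK (fin c1 c2)) -(fineK (fin 0 0)) -EFinD; apply/esym/nneseries_EFin.
pose t c c' m := 2 * pi * (epsj R m * bessel m (eta * r ^+ 2) *
     bessel (2 * m) (psi * r) * cos (m%:R * (2 * c - c'))).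
rewrite (_ : series _ = series (t c1 c2) \+ series (t 0 0)).
  by apply: cvgD; apply: angular_integral_cvg; rewrite ?a0 ?b0.
apply/funext => n; rewrite /series/= -big_split/=; apply: eq_bigr => m _.
by rewrite /t !mulr0 subr0 mulr0 cos0; ring.
Qed.

Let mI c1 c2 : measurable_fun D (fun r => angular_integral (psi * r) (eta * r ^+ 2) c1 c2).
Proof.
have : measurable_fun D (fun r => fine (angular_integral (psi * r) (eta * r ^+ 2) c1 c2)).
  apply: (measurable_fun_cvg (h := fun (N : nat) (r : R) => series (fun m => 2 * pi *
     (epsj R m * bessel m (eta * r ^+ 2) * bessel (2 * m) (psi * r) *
      cos (m%:R * (2 * c1 - c2)))) N)).
    move=> N; apply: measurable_sum => m.
    apply: (eq_measurable_fun (fun r => 2 * pi * epsj R m * cos (m%:R * (2 * c1 - c2)) * BB m r)).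
      by move=> r _; rewrite /BB; ring.
    by apply: measurable_funM => //; exact: measurable_cst.
  by move=> r Dr; apply: angular_integral_cvg; [exact: a0|exact: b0].
move=> /measurable_EFinP; apply: eq_measurable_fun => r; rewrite inE => Dr /=.
by rewrite fineK// angular_integral_fin ?a0 ?b0.
Qed.

(** Monotone convergence is applied to the integrals with phases [(c1, c2)] and
    [(0, 0)] added together, whose expansion has the nonnegative weights
    [1 + cos]; the finite integral with phase [(0, 0)], of weights 1, is then
    subtracted. *)
Lemma radial_angular_series c1 c2 :
  let t m := epsj R m * x ^+ m * cos (m%:R * (2 * c1 - c2)) * DS m in
  cvgn (series t) /\ radial_angular c1 c2 = (alpha / (2 * beta) * limn (series t))%:E.
Proof.
move=> t.
pose k (r : R) := alpha / (2 * pi) * r * expR (- beta * r ^+ 2).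
have k0 r : D r -> 0 <= k r.
  move=> /D0 r0; rewrite mulr_ge0 ?expR_ge0// mulr_ge0// divr_ge0 ?ltW//.
  by rewrite mulr_gt0// pi_gt0.
have mk : measurable_fun D k.
  apply: measurable_funTS; apply: continuous_measurable_fun => s.
  by apply/differentiable_continuous/derivable1_diffP; rewrite /k; exact: ex_derive.
have mkI c c' : measurable_fun D (fun r => ((k r)%:E * angular_integral (psi * r) (eta * r ^+ 2) c c')%E).
  by apply: emeasurable_funM => //; exact/measurable_EFinP.
have kI0 c c' r : D r -> (0 <= (k r)%:E * angular_integral (psi * r) (eta * r ^+ 2) c c')%E.
  by move=> Dr; rewrite mule_ge0 ?angular_integral_ge0// lee_fin k0.
have J0E : radial_angular 0 0 = (\sum_(m <oo) (alpha / (2 * beta) * (epsj R m * (x ^+ m * DS m) * 1))%:E)%E.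
  by apply: integral_bessel_series => // r Dr; exact: I0E.
have JE : (radial_angular c1 c2 + radial_angular 0 0 =
  \sum_(m <oo) (alpha / (2 * beta) * (epsj R m * (x ^+ m * DS m) *
      (1 + cos (m%:R * (2 * c1 - c2)))))%:E)%E.
  rewrite -ge0_integralD//; last 4 first.
  - by move=> r Dr; exact: kI0.
  - exact: mkI.
  - by move=> r Dr; exact: kI0.
  - exact: mkI.
  rewrite -(integral_bessel_series (fun m => 1 + cos (m%:R * (2 * c1 - c2)))
    (fun r => angular_integral (psi * r) (eta * r ^+ 2) c1 c2 +
              angular_integral (psi * r) (eta * r ^+ 2) 0 0)%E).
  - by apply: eq_integral => r _; rewrite [RHS]ge0_muleDr ?angular_integral_ge0.
  - by move=> m; exact: cos1D_ge0.
  - by move=> r Dr; exact: IE.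
(* On the disc, the integrand is bounded by its value with all cosines equal
   to 1 and the radius equal to [u]. *)
have Jly c c' : (radial_angular c c' < +oo)%E.
  pose M := alpha / (2 * pi) * u * (2 * pi * expR (psi * u + eta * u ^+ 2)).
  apply: (@le_lt_trans _ _ (\int[mu]_(r in D) (cst M%:E r))%E).
    apply: ge0_le_integral => //.
    - by move=> r Dr; exact: kI0.
    - exact: mkI.
    - move=> r Dr; have r0 := D0 _ Dr.
      have ru : r <= u by move: Dr; rewrite /D/= in_itv/= => /andP[].
      rewrite /cst /M [X in (_ <= X)%E]EFinM; apply: lee_pmul; rewrite ?angular_integral_ge0 ?lee_fin ?k0//.
        rewrite /k -[leRHS]mulr1 ler_pM ?expR_ge0//.
        + by rewrite mulr_ge0// divr_ge0 ?mulr_ge0 ?pi_ge0// ltW.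
        + by rewrite ler_wpM2l// divr_ge0 ?mulr_ge0 ?pi_ge0// ltW.
        + by rewrite -expR0 ler_expR mulNr oppr_le0 mulr_ge0 ?sqr_ge0// ltW.
      apply: le_trans (angular_integral_le _ _ _ _ (a0 _ Dr) (b0 _ Dr)) _.
      rewrite lee_fin ler_wpM2l ?mulr_ge0 ?pi_ge0// ler_expR lerD ?ler_wpM2l//.
      by rewrite lerXn2r ?nnegrE// ltW.
  rewrite integral_cst//= /D lebesgue_measure_itv/= lte_fin u0 -EFinB -EFinM ltry//.
have J0 c c' : (0 <= radial_angular c c')%E.
  by apply: integral_ge0 => r Dr; exact: kI0.
have C0 : 0 < alpha / (2 * beta) by rewrite divr_gt0// mulr_gt0.
have v0 m : 0 <= epsj R m * (x ^+ m * DS m).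
  by rewrite mulr_ge0 ?DS_ge0// ltW// epsj_gt0.
have h0 m : 0 <= alpha / (2 * beta) * (epsj R m * (x ^+ m * DS m) * 1).
  by rewrite mulr1 mulr_ge0// ltW.
have h1 m : 0 <= alpha / (2 * beta) * (epsj R m * (x ^+ m * DS m) *
      (1 + cos (m%:R * (2 * c1 - c2)))).
  by apply: mulr_ge0; [exact: ltW|apply: mulr_ge0; [exact: v0|exact: cos1D_ge0]].
have l0 : (\sum_(m <oo) (alpha / (2 * beta) * (epsj R m * (x ^+ m * DS m) * 1))%:E < +oo)%E.
  by rewrite -J0E.
have l1 : (\sum_(m <oo) (alpha / (2 * beta) * (epsj R m * (x ^+ m * DS m) *
      (1 + cos (m%:R * (2 * c1 - c2)))))%:E < +oo)%E.
  by rewrite -JE lte_add_pinfty.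
have [cv0 E0] := nneseries_lty_cvg _ h0 l0.
have [cv1 E1] := nneseries_lty_cvg _ h1 l1.
rewrite E0 in J0E; rewrite E1 J0E in JE.
have fin : radial_angular c1 c2 \is a fin_num by rewrite ge0_fin_numE.
rewrite -(fineK fin) -EFinD in JE *; case: JE => JE.
set L0 := limn _ in cv0 JE; set L1 := limn _ in cv1 JE.
have ct : series t @ \oo --> (alpha / (2 * beta))^-1 * fine (radial_angular c1 c2).
  have -> : fine (radial_angular c1 c2) = L1 - L0 by rewrite -JE; ring.
  rewrite (_ : series t = cst (alpha / (2 * beta))^-1 \* (series
    (fun m => alpha / (2 * beta) * (epsj R m * (x ^+ m * DS m) *
      (1 + cos (m%:R * (2 * c1 - c2))))) \- series
    (fun m => alpha / (2 * beta) * (epsj R m * (x ^+ m * DS m) * 1)))).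
    by apply: cvgM; [exact: cvg_cst|apply: cvgB].
  apply/funext => n; rewrite /series/= -sumrB mulr_sumr; apply: eq_bigr => m _.
  by rewrite /t; field; rewrite !gt_eqF.
split; first by apply/cvg_ex; eexists; exact: ct.
by congr EFin; rewrite (cvg_lim _ ct)// mulrA divff ?mul1r// gt_eqF.
Qed.

End Assembly.

(** * The bivariate normal density in polar coordinates *)

Section Density.
Context {R : realType}.
Variables (mu1 mu2 s1 s2 rho phit phi : R).
Hypotheses (hs1 : 0 < s1) (hs2 : 0 < s2) (hrho : `|rho| < 1).

Let K := s1 ^+ 2 * s2 ^+ 2 * (1 - rho ^+ 2).

Lemma one_sub_rho2_gt0 : 0 < 1 - rho ^+ 2.
Proof. by rewrite subr_gt0 -real_normK ?num_real// expr_lt1. Qed.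

Lemma det_cov2_gt0 : 0 < K.
Proof. by rewrite /K !mulr_gt0 ?exprn_gt0// one_sub_rho2_gt0. Qed.

Let K0 : K != 0. Proof. by rewrite gt_eqF// det_cov2_gt0. Qed.
Let r0 : 1 - rho ^+ 2 != 0. Proof. by rewrite gt_eqF// one_sub_rho2_gt0. Qed.
Let s10 : s1 != 0. Proof. by rewrite gt_eqF. Qed.
Let s20 : s2 != 0. Proof. by rewrite gt_eqF. Qed.

Let L1 := (mu1 * s2 ^+ 2 - rho * mu2 * s1 * s2) / K.
Let L2 := (mu2 * s1 ^+ 2 - rho * mu1 * s1 * s2) / K.

Lemma det_cov2 : \det (cov2 s1 s2 rho) = K.
Proof.
rewrite (expand_det_row _ 0) !big_ord_recl big_ord0 /cofactor !det_mx11 !mxE/=.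
by rewrite /K !(add0n, addn0, expr0, expr1) /=; ring.
Qed.

(** The inverse matrix is avoided: the solution [w] of [S w = v] is checked
    directly. *)
Lemma invmx_cov2_form (a b : R) :
  ((colvec2 a b)^T *m invmx (cov2 s1 s2 rho) *m colvec2 a b) 0 0 =
  (s2 ^+ 2 * a ^+ 2 - 2 * rho * s1 * s2 * a * b + s1 ^+ 2 * b ^+ 2) / K.
Proof.
pose w := colvec2 ((s2 ^+ 2 * a - rho * s1 * s2 * b) / K)
                  ((s1 ^+ 2 * b - rho * s1 * s2 * a) / K).
have Sw : cov2 s1 s2 rho *m w = colvec2 a b.
  apply/matrixP => i j; rewrite !mxE !big_ord_recl big_ord0 !mxE/=.
  case: i => [[|[|//]] ?] /=; rewrite /K; field; rewrite ?r0 ?s10 ?s20//.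
have Su : cov2 s1 s2 rho \in unitmx by rewrite unitmxE det_cov2 unitfE.
rewrite -mulmxA -[in X in _ *m (_ *m X)]Sw mulKmx// !mxE !big_ord_recl big_ord0 !mxE/=.
by rewrite /K; field; rewrite r0 s10 s20.
Qed.

Lemma normal2_pdfE (x : R * R) :
  normal2_pdf (colvec2 mu1 mu2) (cov2 s1 s2 rho) x =
  alphac mu1 mu2 s1 s2 rho / (2 * pi) *
  expR (L1 * x.1 + L2 * x.2
        - (s2 ^+ 2 * x.1 ^+ 2 - 2 * rho * s1 * s2 * x.1 * x.2 + s1 ^+ 2 * x.2 ^+ 2) / (2 * K)).
Proof.
rewrite /normal2_pdf.
have -> : colvec2 x.1 x.2 - colvec2 mu1 mu2 = colvec2 (x.1 - mu1) (x.2 - mu2).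
  by apply/matrixP => i j; rewrite !mxE; case: ifP.
rewrite invmx_cov2_form det_cov2 /alphac.
have -> : Num.sqrt K = s1 * s2 * Num.sqrt (1 - rho ^+ 2).
  by rewrite /K -exprMn sqrtrM ?sqr_ge0// sqrtr_sqr ger0_norm// mulr_ge0// ltW.
set E := (X in expR X); set B := L1 * _ + _ - _; set A := - (_ / (2 * s1 ^+ 2 * _ * _)).
rewrite (_ : E = A + B); last first.
  by rewrite /E /A /B /L1 /L2 /K; field; rewrite r0 s10 s20.
have sq0 : Num.sqrt (1 - rho ^+ 2) != 0 by rewrite gt_eqF// sqrtr_gt0 one_sub_rho2_gt0.
have p0 : (pi : R) != 0 by rewrite gt_eqF// pi_gt0.
by rewrite expRD; move: (pi : R) p0 => p p0; field; rewrite p0 sq0 s10 s20.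
Qed.

(** The linear part of the exponent in phase-amplitude form.  If the amplitude
    vanishes, both coefficients do, whatever the angle. *)
Lemma psi_phit : is_phitilde mu1 mu2 s1 s2 rho phit ->
  psic mu1 mu2 s1 s2 rho * sin phit = L1 /\ psic mu1 mu2 s1 s2 rho * cos phit = L2.
Proof.
rewrite /is_phitilde /is_angle.
set N := mu1 ^+ 2 * s2 ^+ 4 + _ + _ - _.
have NE : N = (mu1 * s2 ^+ 2 - rho * mu2 * s1 * s2) ^+ 2 + (mu2 * s1 ^+ 2 - rho * mu1 * s1 * s2) ^+ 2.
  by rewrite /N; ring.
have N0 : 0 <= N by rewrite NE addr_ge0// sqr_ge0.
rewrite /psic -/K.
have -> : s1 ^+ 2 * (rho * mu1 * s2 - mu2 * s1) ^+ 2
          + s2 ^+ 2 * (rho * mu2 * s1 - mu1 * s2) ^+ 2 = N by rewrite /N; ring.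
 have [D0 _|D0 /(_ isT)[-> ->]] := eqVneq (Num.sqrt N) 0.
  rewrite D0 !mul0r.
  have /eqP : N = 0 by move/eqP: D0; rewrite sqrtr_eq0 => h; apply/eqP; rewrite eq_le h N0.
  rewrite NE paddr_eq0 ?sqr_ge0// !sqrf_eq0 => /andP[/eqP l1 /eqP l2].
  by rewrite /L1 /L2 l1 l2 !mul0r.
by rewrite /L1 /L2; split; field; rewrite D0 K0.
Qed.

(** The same for the trace-free part of the quadratic form. *)
Lemma eta_phi : is_phi s1 s2 rho phi ->
  etac s1 s2 rho * cos phi = (s2 ^+ 2 - s1 ^+ 2) / (4 * K) /\
  etac s1 s2 rho * sin phi = 2 * rho * s1 * s2 / (4 * K).
Proof.
rewrite /is_phi /is_angle.
set N := (s1 ^+ 2 - s2 ^+ 2) ^+ 2 + _.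
have NE : N = (s2 ^+ 2 - s1 ^+ 2) ^+ 2 + (2 * rho * s1 * s2) ^+ 2 by rewrite /N; ring.
have N0 : 0 <= N by rewrite NE addr_ge0// sqr_ge0.
rewrite /etac.
have -> : (s2 ^+ 2 - s1 ^+ 2) ^+ 2 + 4 * s1 ^+ 2 * s2 ^+ 2 * rho ^+ 2 = N.
  by rewrite /N; ring.
rewrite (_ : 4 * s1 ^+ 2 * s2 ^+ 2 * (1 - rho ^+ 2) = 4 * K); last by rewrite /K; ring.
have [D0 _|D0 /(_ isT)[-> ->]] := eqVneq (Num.sqrt N) 0.
  rewrite D0 !mul0r.
  have /eqP : N = 0 by move/eqP: D0; rewrite sqrtr_eq0 => h; apply/eqP; rewrite eq_le h N0.
  rewrite NE paddr_eq0 ?sqr_ge0// !sqrf_eq0 => /andP[/eqP -> /eqP ->].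
  by rewrite !mul0r.
by split; field; rewrite D0 K0.
Qed.

(** The shifts by [pi / 2] and [pi] turn the sine of the linear part and the
    negative quadratic part into cosines with positive amplitudes.  With these
    phases, [2 c1 - c2] is [2 phit - phi], the double of [delta]. *)
Lemma normal2_pdf_polar (r t : R) :
  is_phitilde mu1 mu2 s1 s2 rho phit -> is_phi s1 s2 rho phi ->
  normal2_pdf (colvec2 mu1 mu2) (cov2 s1 s2 rho) (r * cos t, r * sin t) =
  alphac mu1 mu2 s1 s2 rho / (2 * pi) * expR (- betac s1 s2 rho * r ^+ 2) *
  angular_exp (psic mu1 mu2 s1 s2 rho * r) (etac s1 s2 rho * r ^+ 2)
    (phit - pi / 2) (phi - pi) t.
Proof.
move=> /psi_phit[e1 e2] /eta_phi[e3 e4].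
rewrite normal2_pdfE -[RHS]mulrA; congr (_ * _).
rewrite /angular_exp -expRD; congr expR => /=.
have -> : cos (t + (phit - pi / 2)) = sin (t + phit) by rewrite addrA cosBpihalf.
have -> : cos (2 * t + (phi - pi)) = - cos (2 * t + phi).
  by rewrite addrA cosB cospi sinpi mulr0 addr0 mulrN1.
rewrite (_ : 2 * t = t + t); last by ring.
rewrite !(sinD, cosD).
set c := cos t; set s := sin t.
have cs : c ^+ 2 = 1 - s ^+ 2 by rewrite -(cos2Dsin2 t) addrK.
transitivity (- betac s1 s2 rho * r ^+ 2 + r * (s * (psic mu1 mu2 s1 s2 rho * cos phit)
   + c * (psic mu1 mu2 s1 s2 rho * sin phit)) -
   r ^+ 2 * ((c * c - s * s) * (etac s1 s2 rho * cos phi) - (s * c + c * s) * (etac s1 s2 rho * sin phi))); last by ring.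
rewrite e1 e2 e3 e4.
have -> : betac s1 s2 rho = (s1 ^+ 2 + s2 ^+ 2) * (c ^+ 2 + s ^+ 2) / (4 * K).
  by rewrite cs /betac /K; field; rewrite r0 s10 s20.
by rewrite /L1 /L2; field.
Qed.

Lemma alphac_gt0 : 0 < alphac mu1 mu2 s1 s2 rho.
Proof.
by rewrite /alphac mulr_gt0 ?expR_gt0// invr_gt0 !mulr_gt0// sqrtr_gt0 one_sub_rho2_gt0.
Qed.

Lemma betac_gt0 : 0 < betac s1 s2 rho.
Proof.
rewrite /betac divr_gt0 ?addr_gt0 ?exprn_gt0//.
by rewrite !mulr_gt0 ?exprn_gt0 ?one_sub_rho2_gt0.
Qed.

Lemma etac_ge0 : 0 <= etac s1 s2 rho.
Proof.
rewrite /etac divr_ge0 ?sqrtr_ge0// !mulr_ge0 ?exprn_ge0// ?(ltW one_sub_rho2_gt0)// ltW//.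
Qed.

Lemma psic_ge0 : 0 <= psic mu1 mu2 s1 s2 rho.
Proof. by rewrite /psic divr_ge0 ?sqrtr_ge0// -/K ltW// det_cov2_gt0. Qed.

(** The numerators are the difference and the sum of the eigenvalues of the
    covariance matrix; the difference of their squares is
    four times its determinant. *)
Lemma etac_lt_betac : etac s1 s2 rho < betac s1 s2 rho.
Proof.
rewrite /etac /betac ltr_pM2r; last first.
  by rewrite invr_gt0 !mulr_gt0 ?exprn_gt0 ?one_sub_rho2_gt0.
have h : 0 < s1 ^+ 2 + s2 ^+ 2 by rewrite addr_gt0 ?exprn_gt0.
rewrite -[ltRHS](ger0_norm (ltW h)) -sqrtr_sqr ltr_sqrt ?exprn_gt0//.
rewrite -subr_gt0 (_ : _ - _ = 4 * K); last by rewrite /K; ring.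
by rewrite mulr_gt0// det_cov2_gt0.
Qed.

End Density.

(** * The distribution function of the norm *)

Section Cdf.
Context {R : realType}.
Local Notation mu := (@lebesgue_measure R).
Variables (mu1 mu2 s1 s2 rho phit phi : R).
Hypotheses (hs1 : 0 < s1) (hs2 : 0 < s2) (hrho : `|rho| < 1).

Lemma measurable_normal2_pdf :
  measurable_fun setT (normal2_pdf (colvec2 mu1 mu2) (cov2 s1 s2 rho)).
Proof.
rewrite (funext (normal2_pdfE mu1 mu2 s1 s2 rho hs1 hs2 hrho)).
apply: measurable_funM; first exact: measurable_cst.
apply: measurableT_comp => //.
have mf1 : measurable_fun setT (fst : R * R -> R) by exact: measurable_fst.
have mf2 : measurable_fun setT (snd : R * R -> R) by exact: measurable_snd.
by repeat first [exact: measurable_cst | exact: mf1 | exact: mf2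
  | apply: measurable_funB | apply: measurable_funD
  | apply: measurable_funX | apply: measurable_funM].
Qed.

Lemma normal2_pdf_ge0 x : 0 <= normal2_pdf (colvec2 mu1 mu2) (cov2 s1 s2 rho) x.
Proof.
by rewrite /normal2_pdf mulr_ge0 ?expR_ge0// invr_ge0 !mulr_ge0 ?pi_ge0 ?sqrtr_ge0.
Qed.

Lemma sin_atan (s : R) : sin (atan s) = s * cos (atan s).
Proof.
have c0 : cos (atan s) != 0.
  by rewrite gt_eqF// cos_gt0_pihalf// atan_gtNpi2 atan_ltpi2.
by rewrite -[X in X * _]atanK /tan mulfVK.
Qed.

Lemma enorm2_polar (r t : R) : 0 <= r -> enorm2 (r * cos t, r * sin t) = r.
Proof.
move=> r0; rewrite /enorm2/= !exprMn -mulrDr cos2Dsin2 mulr1.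
by rewrite sqrtr_sqr ger0_norm.
Qed.

Context (d : measure_display) (T : measurableType d) (P : probability T R)
    (X : {RV P >-> (R * R)%type}).
Hypothesis hX : is_normal2 X (colvec2 mu1 mu2) (cov2 s1 s2 rho).
Hypothesis hphit : is_phitilde mu1 mu2 s1 s2 rho phit.
Hypothesis hphi : is_phi s1 s2 rho phi.

(** The density is integrated over the disc with [ge0_integral_polar], in which
    the tangent [s] is rewritten as the angle [atan s]. *)
Lemma cdf_enorm_polar (u : R) :
  cdf (enorm_rv X) u = (\int[mu]_(r in `]0%R, +oo[)
    if (r <= u)%R then
      ((alphac mu1 mu2 s1 s2 rho / (2 * pi) * r * expR (- betac s1 s2 rho * r ^+ 2))%:E *
       angular_integral (psic mu1 mu2 s1 s2 rho * r) (etac s1 s2 rho * r ^+ 2)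
         (phit - pi / 2) (phi - pi))%E
    else 0)%E.
Proof.
set pdf := normal2_pdf (colvec2 mu1 mu2) (cov2 s1 s2 rho).
pose B := [set z : R * R | enorm2 z <= u].
have BE : B = enorm2 (R:=R) @^-1` `]-oo, u].
  by apply/seteqP; split => z /=; rewrite in_itv.
have mB : measurable B.
  by rewrite BE -[X in measurable X]setTI; exact: measurable_enorm2.
have -> : cdf (enorm_rv X) u = distribution P X B by rewrite BE.
rewrite hX// integral_mkcond.
pose f := (fun z => (pdf z)%:E) \_ B.
have mf : measurable_fun setT f.
  apply/(measurable_restrictT _ mB).
  by apply/measurable_funTS/measurable_EFinP; exact: measurable_normal2_pdf.
have f0 z : (0 <= f z)%E.
  by rewrite /f patchE; case: ifP => // _; rewrite lee_fin normal2_pdf_ge0.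
rewrite (ge0_integral_polar f)//.
apply: eq_integral => r; rewrite inE/= in_itv/= andbT => r0.
have fE t : f (r * cos t, r * sin t) = if r <= u then
    (alphac mu1 mu2 s1 s2 rho / (2 * pi) * expR (- betac s1 s2 rho * r ^+ 2) *
    angular_exp (psic mu1 mu2 s1 s2 rho * r) (etac s1 s2 rho * r ^+ 2)
    (phit - pi / 2) (phi - pi) t)%:E else 0%E.
  have Bin : ((r * cos t, r * sin t) \in B) = (r <= u).
    rewrite -[in RHS](enorm2_polar r t (ltW r0)).
    by apply/idP/idP => [|h]; [rewrite inE|rewrite inE].
  by rewrite /f patchE Bin -(normal2_pdf_polar _ _ _ _ _ phit phi).
transitivity (\int[mu]_s ((r / (1 + s ^+ 2))%:E *
   (f (r * cos (atan s), r * sin (atan s))%R +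
    f (r * cos (atan s + pi), r * sin (atan s + pi))%R)))%E.
  apply: eq_integral => s _.
  by rewrite sinDpi cosDpi !mulrN sin_atan cos_atan.
under eq_integral => s _ do rewrite !fE.
case: ifPn => ru; last by rewrite integral0_eq// => s _; rewrite adde0 mule0.
rewrite /angular_integral -ge0_integralZl_EFin//; last 3 first.
- move=> s _; rewrite lee_fin mulr_ge0 ?addr_ge0 ?expR_ge0//.
  by rewrite invr_ge0 addr_ge0// sqr_ge0.
- exact: (measurable_atan_weight _ (continuous_angular_exp _ _ _ _)).
- have a0 : 0 <= alphac mu1 mu2 s1 s2 rho by rewrite ltW ?alphac_gt0.
  by rewrite mulr_ge0 ?expR_ge0// mulr_ge0 ?(ltW r0)// (divr_ge0 a0)// mulr_ge0 ?pi_ge0.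
apply: eq_integral => s _; rewrite -EFinD -!EFinM; congr EFin; ring.
Qed.

End Cdf.

Theorem claim1 (R : realType) (d : measure_display) (T : measurableType d)
    (P : probability T R)
    (X : {RV P >-> (R * R)%type})
    (mu1 mu2 s1 s2 rho phit phi : R)
    (hs1 : 0 < s1) (hs2 : 0 < s2) (hrho : `|rho| < 1)
    (hX : is_normal2 X (colvec2 mu1 mu2) (cov2 s1 s2 rho))
    (hphit : is_phitilde mu1 mu2 s1 s2 rho phit)
    (hphi : is_phi s1 s2 rho phi) :
  let alpha := alphac mu1 mu2 s1 s2 rho in
  let beta := betac s1 s2 rho in
  let eta := etac s1 s2 rho in
  let psi := psic mu1 mu2 s1 s2 rho in
  let delta := phit - phi / 2 in
  let S1 (j k1 k2 : nat) : R := T1 beta psi eta k1 k2 j in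
  let S2 (u : R) (j k1 k2 : nat) : R :=
    \sum_(1 <= k < (ell k1 k2 j + 1).+1) T2 beta u psi eta k1 k2 j k in
  let term (u : R) (j : nat) : R :=
    epsj R j * (eta * psi ^+ 2 / 8) ^+ j * cos ((2 * j)%:R * delta)
    * (dseries (S1 j) - expR (- beta * u ^+ 2) * dseries (S2 u j)) in
  (forall u : R, 0 < u ->
     [/\ forall j : nat, dseries_cvg (S1 j),
         forall j : nat, dseries_cvg (S2 u j),
         cvgn (series (term u))
       & cdf (enorm_rv X) u = (alpha / (2 * beta) * limn (series (term u)))%:E])
  /\ (forall u : R, u <= 0 -> cdf (enorm_rv X) u = 0%E).
Proof.
move=> alpha beta eta psi delta S1 S2 term.
have alpha0 : 0 < alpha by exact: alphac_gt0.
have beta0 : 0 < beta by exact: betac_gt0.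
have psi0 : 0 <= psi by exact: psic_ge0.
have eta0 : 0 <= eta by exact: etac_ge0.
have etab : eta < beta by exact: etac_lt_betac.
split=> u u0; last first.
  rewrite (cdf_enorm_polar mu1 mu2 s1 s2 rho phit phi)//.
  rewrite integral0_eq// => r /=; rewrite in_itv/= andbT => r0.
  by rewrite leNgt (le_lt_trans u0 r0).
have [ct cdfE] := radial_angular_series _ _ _ beta0 psi0 eta0 etab _ _ u0 alpha0
  (phit - pi / 2) (phi - pi).
have tE : term u = fun m : nat => epsj R m * (eta * psi ^+ 2 / 8) ^+ m *
    cos (m%:R * (2 * (phit - pi / 2) - (phi - pi))) *
    (dseries (S1 m) - expR (- beta * u ^+ 2) * dseries (S2 u m)).
  apply/funext => m; rewrite /term /delta; congr (_ * cos _ * _).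
  by rewrite natrM; field.
rewrite tE; split => //.
- by move=> j; have [] := dseries_inc_gamma _ _ _ beta0 psi0 eta0 etab _ u0 j.
- by move=> j; have [] := dseries_inc_gamma _ _ _ beta0 psi0 eta0 etab _ u0 j.
rewrite (cdf_enorm_polar mu1 mu2 s1 s2 rho phit phi)// -cdfE /radial_angular.
rewrite integral_mkcond [RHS]integral_mkcond; apply: eq_integral => r _.
rewrite !patchE !mem_setE !in_itv/= andbT.
by case: (0 < r) => //=.
Qed.
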